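(* Let $A\subseteq[0,1]$ be an infinite compact set containing $0$ and $1$ and closed under $\min$ and $\max$, and let $\neg\colon A\to A$ be a continuous operation such that, in $\mathbf{A}=\langle A,\wedge,\vee,\neg\rangle$ (with $\wedge=\min$, $\vee=\max$): (1) $\neg(v\wedge w)=\neg v\vee\neg w$ and $\neg(v\vee w)=\neg v\wedge\neg w$; (2) $v\le\neg\neg v$; (3) $\neg1=0$. Then $\mathcal{L}^{\mathbf{A}}$ satisfies the zero-one law (for every sentence $\varphi$ there is a unique $a\in A$ with $\lim_{n\to\infty}\mu_n(\varphi\in V)=1$ for every open set $V$ containing $a$), and its only almost sure values are $0$, $1$, $\varepsilon=\sup_{x\in A}(x\wedge\neg x)$, $\varepsilon'=\sup_{x\in A}(\neg x\wedge\neg\neg x)$, $\delta=\inf_{x\in A}(x\vee\neg x)$, and $\delta'=\inf_{x\in A}(\neg x\vee\neg\neg x)$.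
   Context: For a finite relational vocabulary $\tau$, formulas of $\mathcal{L}^{\mathbf{A}}(\tau)$ are built from atomic formulas $R(x_1,\dots,x_{\tau(R)})$ with connectives $\wedge,\vee,\neg$ and quantifiers $\forall,\exists$, evaluated in structures $\mathfrak{M}$ (nonempty domain $M$, maps $R^{\mathfrak{M}}\colon M^{\tau(R)}\to A$) via the operations of $\mathbf{A}$, with $\forall$ as infimum and $\exists$ as supremum. For each $R\in\tau$, $p_R$ is a Borel probability measure on $A$ giving positive measure to every nonempty relatively open subset of $A$; structures with domain $[n]=\{1,\dots,n\}$ form the space $\prod_{R\in\tau}A^{[n]^{\tau(R)}}$ with the product measure $\rho_n$, and $\mu_n(\varphi\in S)=\rho_n\{\mathfrak{M}:\|\varphi\|^{\mathfrak{M}}\in S\}$. An element $a\in A$ is an almost sure value if some sentence $\varphi$ satisfies $\lim_n\mu_n(\varphi\in V)=1$ for every open $V\ni a$.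
   Formalization: All relation symbols are assumed to have positive arity (for a nullary R the sentence R() has the non-degenerate law p_R for every n, so the law fails), and that each listed value is an almost sure value is claimed only for a nonempty vocabulary (the empty one has no sentences). *)

(* Defs.v *)
From HB Require Import structures.
From mathcomp Require Import all_boot all_order all_algebra.
From mathcomp Require Import all_classical all_reals all_analysis.

Set Implicit Arguments.
Unset Strict Implicit.
Unset Printing Implicit Defensive.

Import Order.TTheory GRing.Theory Num.Theory.
Import numFieldNormedType.Exports.

Local Open Scope classical_set_scope.
Local Open Scope ring_scope.

Section product_probability.
Local Open Scope ereal_scope.
Context d (T : measurableType d) (R : realType).

Definition tcons n (xt : T * n.-tuple T) : n.+1.-tuple T :=
  [tuple of xt.1 :: xt.2].

Lemma measurable_tcons n : measurable_fun [set: T * n.-tuple T] (@tcons n).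
Proof. exact: measurable_cons. Qed.

HB.instance Definition _ n :=
  isMeasurableFun.Build _ _ _ _ (@tcons n) (@measurable_tcons n).

(* The finite product P_0 x ... x P_(n-1), as a probability on the product
   sigma-algebra of n.-tuple T; product_probability_rect is its
   characterization on measurable rectangles. *)
Fixpoint product_probability n :
    ('I_n -> probability T R) -> probability (n.-tuple T) R :=
  match n with
  | 0 => fun _ => \d_([tuple])
  | m.+1 => fun P => distribution
      (P ord0 \x product_probability (fun i => P (lift ord0 i))) (@tcons m)
  end.

Lemma product_probability_rect n (P : 'I_n -> probability T R)
    (B : 'I_n -> set T) : (forall i, measurable (B i)) ->
  product_probability P [set t | forall i, B i (tnth t i)]
  = \prod_(i < n) P i (B i).
Proof.
elim: n P B => [|n IH] P B mB /=.
  by rewrite big_ord0 diracE mem_set//= => -[].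
rewrite big_ord_recl -IH// -product_measure1E//; last first.
  rewrite (_ : [set _ | _] = \big[setI/setT]_(i < n)
      ((fun t : n.-tuple T => tnth t i) @^-1` B (lift ord0 i))).
    apply: bigsetI_measurable => i _.
    by rewrite -[X in measurable X]setTI; exact: measurable_tnth.
  rewrite -bigcap_seq; apply/seteqP; split=> t /= tB i.
    by move=> _; exact: tB.
  by apply: tB; rewrite /= mem_index_enum.
rewrite /distribution /pushforward; congr (product_measure1 _ _ _).
apply/seteqP; split=> -[x t] /=.
  move=> xtB; split=> [|i]; first exact: (xtB ord0).
  by have := xtB (lift ord0 i); rewrite tnthS.
move=> [xB tB] i; case: (unliftP ord0 i) => [j|] ->; last exact: xB.
by rewrite tnthS.
Qed.

End product_probability.

Section logic.
Context (R : realType) (Rel : finType) (ar : Rel -> nat).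

Inductive formula :=
| Atom (r : Rel) of (ar r).-tuple nat
| And of formula & formula
| Or of formula & formula
| Neg of formula
| Forall of nat & formula
| Exists of nat & formula.

Fixpoint free_vars (f : formula) : seq nat :=
  match f with
  | Atom _ xs => xs
  | And f g | Or f g => free_vars f ++ free_vars g
  | Neg f => free_vars f
  | Forall x f | Exists x f => [seq y <- free_vars f | y != x]
  end.

Definition sentence (f : formula) : Prop := free_vars f = [::].

Definition interpretation (D : Type) : Type :=
  forall r : Rel, (ar r).-tuple D -> R.

Definition update (D : Type) (v : nat -> D) (x : nat) (a : D) : nat -> D :=
  fun y => if y == x then a else v y.

Fixpoint value (neg : R -> R) (D : Type) (M : interpretation D)
    (v : nat -> D) (f : formula) : R :=
  match f with
  | Atom r xs => M r (map_tuple v xs)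
  | And f g => Num.min (value neg M v f) (value neg M v g)
  | Or f g => Num.max (value neg M v f) (value neg M v g)
  | Neg f => neg (value neg M v f)
  | Forall x f => inf (range (fun a => value neg M (update v x a) f))
  | Exists x f => sup (range (fun a => value neg M (update v x a) f))
  end.

Definition atom_index (n : nat) : finType := {r : Rel & (ar r).-tuple 'I_n}.

(* A point of R^(atom_index n), its coordinates listed along the enumeration
   of atom_index n, read as an interpretation with domain 'I_n. *)
Definition interp_of n (w : #|atom_index n|.-tuple R) : interpretation 'I_n :=
  fun r xs => tnth w (enum_rank (existT _ r xs : atom_index n)).

Definition rho (p : Rel -> probability R R) n :
    probability (#|atom_index n|.-tuple R) R :=
  product_probability (fun i => p (tag (enum_val i : atom_index n))).

(* mu A neg p n phi S is the probability that phi takes a value in S in a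
   random structure with domain of size n.+1, so that domains are nonempty.
   Each p r is carried by A, hence rho by the A-valued interpretations; the
   intersection with the latter makes the event independent of the behaviour
   of neg outside A.  The assignment is irrelevant when phi is a sentence. *)
Definition mu (A : set R) (neg : R -> R) (p : Rel -> probability R R)
    (n : nat) (phi : formula) (S : set R) : \bar R :=
  rho p n.+1 [set w | (forall i, A (tnth w i)) /\
                      S (value neg (interp_of w) (fun=> ord0) phi)].

Definition almost_surely (A : set R) (neg : R -> R)
    (p : Rel -> probability R R) (phi : formula) (a : R) : Prop :=
  forall V : set R, open V -> V a ->
    mu A neg p n phi V @[n --> \oo] --> 1%E.

Definition zero_one_law (A : set R) (neg : R -> R)
    (p : Rel -> probability R R) : Prop :=
  forall phi, sentence phi ->
    exists! a, A a /\ almost_surely A neg p phi a.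

Definition almost_sure_value (A : set R) (neg : R -> R)
    (p : Rel -> probability R R) (a : R) : Prop :=
  A a /\ exists2 phi, sentence phi & almost_surely A neg p phi a.

End logic.

(* Main.v *)
Require Import Defs.
From HB Require Import structures.
From mathcomp Require Import all_boot all_order all_algebra.
From mathcomp Require Import all_classical all_reals all_analysis.
From mathcomp Require Import measurable_realfun ring lra zify.
Import Order.TTheory GRing.Theory Num.Theory.
Import numFieldNormedType.Exports.

Local Open Scope classical_set_scope.
Local Open Scope ring_scope.

Set Implicit Arguments.
Unset Strict Implicit.
Unset Printing Implicit Defensive.

(** The idea is an approximate quantifier elimination.  By the De Morgan laws and
    [neg (neg (neg x)) = neg x], a quantifier-free formula is a lattice term in
    the literals [x], [neg x], [neg (neg x)] of its atoms.  Put such a term in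
    disjunctive normal form: the supremum over a fresh point can be taken clause
    by clause and, the atoms being independent, atom by atom, which produces only
    the constants [1], [epsilon], [epsilon'] (dually, an infimum produces [0],
    [delta], [delta']), and this set of constants is closed under [neg].  The
    suprema are attained, so they are nearly realized as soon as finitely many
    extension axioms hold, asserting that over every [k] distinct points some new
    point has its atoms close to prescribed values.  An extension axiom fails in
    a random structure with at most [n ^ k] times a geometric probability,
    because the candidates for the new point are independent.  A sentence thus
    approximates a lattice term without atoms, that is, a listed constant. *)

(** * Lattice terms and elimination of suprema *)

Section uniform_continuity.
Context {R : realType}.
Implicit Types (A : set R) (f g : R -> R).

Definition unif_on A f := forall eta : R, 0 < eta ->
  exists2 theta : R, 0 < theta &
    forall x y, A x -> A y -> `|x - y| < theta -> `|f x - f y| < eta.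

Lemma within_continuous_unif_on A f :
  compact A -> {within A, continuous f} -> unif_on A f.
Proof.
move=> cA /subspace_continuousP cf eta eta0.
(* Near-covering form of compactness: a modulus that works near each point of [A] is, once small
   enough, valid on all of [A]. *)
have /(_ _ (0 : R)^'+ (fun theta x => A x -> forall y, A y ->
    `|x - y| < theta -> `|f x - f y| < eta)) :=
  (iffLR (compact_near_coveringP A) cA).
case=> [x Ax|theta /= theta0 Htheta].
  have /cvgrPdist_lt/(_ (eta / 2)) := cf _ Ax.
  rewrite divr_gt0// => /(_ isT) [r /= r0 rP].
  exists (ball x (r / 2), [set t | t < r / 2]).
    split; first by apply: nbhsx_ballx; rewrite divr_gt0.
    by apply: nbhs_right_lt; rewrite divr_gt0.
  move=> [x' t] [/= xx' tr] Ax' y Ay x'y.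
  have h1 : `|f x - f x'| < eta / 2.
    by apply: rP => //=; rewrite (lt_trans xx')// ltr_pdivrMr// ltr_pMr// ltr1n.
  have h2 : `|f x - f y| < eta / 2.
    apply: rP => //=; rewrite (le_lt_trans (ler_distD x' _ _))//.
    by rewrite [r]splitr ltrD// (lt_trans x'y).
  rewrite (le_lt_trans (ler_distD (f x) _ _))// [eta]splitr ltrD//.
  by rewrite distrC.
exists (theta / 2); first by rewrite divr_gt0.
move=> x y Ax Ay xy; apply: (Htheta (theta / 2)) => //=.
  rewrite sub0r normrN gtr0_norm ?divr_gt0//.
  by rewrite ltr_pdivrMr// ltr_pMr// ltr1n.
by rewrite divr_gt0.
Qed.

Lemma unif_on_within_continuous A f :
  unif_on A f -> {within A, continuous f}.
Proof.
move=> uf; apply/subspace_continuousP => x Ax.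
apply/cvgrPdist_lt => eta /uf[theta theta0 H].
by exists theta => //= y /= xy Ay; exact: H.
Qed.

Lemma unif_on_comp A f g : (forall x, A x -> A (g x)) ->
  unif_on A f -> unif_on A g -> unif_on A (f \o g).
Proof.
move=> Ag uf ug eta /uf[theta /ug[theta' theta'0 H'] H].
by exists theta' => // x y Ax Ay xy /=; apply: H; [exact: Ag..|exact: H'].
Qed.

Lemma ltr_dist_min (x x' y y' e : R) : `|x - x'| < e -> `|y - y'| < e ->
  `|Num.min x y - Num.min x' y'| < e.
Proof.
rewrite !ltr_distl => /andP[? ?] /andP[? ?].
have [?|?] := leP x y; have [?|?] := leP x' y'; apply/andP; split; lra.
Qed.

Lemma ltr_dist_max (x x' y y' e : R) : `|x - x'| < e -> `|y - y'| < e ->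
  `|Num.max x y - Num.max x' y'| < e.
Proof.
rewrite !ltr_distl => /andP[? ?] /andP[? ?].
have [?|?] := leP x y; have [?|?] := leP x' y'; apply/andP; split; lra.
Qed.

Lemma ler_dist_min (x x' y y' e : R) : `|x - x'| <= e -> `|y - y'| <= e ->
  `|Num.min x y - Num.min x' y'| <= e.
Proof.
rewrite !ler_distl => /andP[? ?] /andP[? ?].
have [?|?] := leP x y; have [?|?] := leP x' y'; apply/andP; split; lra.
Qed.

Lemma ler_dist_max (x x' y y' e : R) : `|x - x'| <= e -> `|y - y'| <= e ->
  `|Num.max x y - Num.max x' y'| <= e.
Proof.
rewrite !ler_distl => /andP[? ?] /andP[? ?].
have [?|?] := leP x y; have [?|?] := leP x' y'; apply/andP; split; lra.
Qed.

Lemma unif_on_min A f g : unif_on A f -> unif_on A g ->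
  unif_on A (fun x => Num.min (f x) (g x)).
Proof.
move=> uf ug eta eta0.
have [t1 t10 H1] := uf _ eta0; have [t2 t20 H2] := ug _ eta0.
exists (Num.min t1 t2) => [|x y Ax Ay]; first by rewrite lt_min t10.
by rewrite lt_min => /andP[? ?]; apply: ltr_dist_min; [exact: H1|exact: H2].
Qed.

Lemma unif_on_max A f g : unif_on A f -> unif_on A g ->
  unif_on A (fun x => Num.max (f x) (g x)).
Proof.
move=> uf ug eta eta0.
have [t1 t10 H1] := uf _ eta0; have [t2 t20 H2] := ug _ eta0.
exists (Num.min t1 t2) => [|x y Ax Ay]; first by rewrite lt_min t10.
by rewrite lt_min => /andP[? ?]; apply: ltr_dist_max; [exact: H1|exact: H2].
Qed.

End uniform_continuity.

(** * Lattice terms, disjunctive normal form and elimination of suprema *)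

Section lattice_terms.
Context {R : realType} {I : eqType}.
Implicit Types (A K : set R) (G : nat -> R -> R) (P : pred I).
Implicit Types (f : (I -> R) -> R) (w u : I -> R).

Definition valued A w := forall i, A (w i).

(* Lattice terms whose literals [G j (w i)] come from the unary functions [G]
   (here the iterates of negation) and whose constants lie in [K]. *)
Inductive lterm K G P : ((I -> R) -> R) -> Prop :=
| lterm_cst c : K c -> lterm K G P (fun=> c)
| lterm_lit j i : P i -> lterm K G P (fun w => G j (w i))
| lterm_min f g : lterm K G P f -> lterm K G P g ->
    lterm K G P (fun w => Num.min (f w) (g w))
| lterm_max f g : lterm K G P f -> lterm K G P g ->
    lterm K G P (fun w => Num.max (f w) (g w)).

(** Changing signs exchanges minima and maxima; the elimination of infima is reduced in this way to
    that of suprema. *)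
Lemma lterm_opp K G P f : lterm K G P f ->
  lterm [set - x | x in K] (fun j x => - G j x) P (fun w => - f w).
Proof.
elim=> [c Kc|j i Pi|{}f g _ IHf _ IHg|{}f g _ IHf _ IHg].
- by apply: lterm_cst; exists c.
- exact: (@lterm_lit _ (fun j x => - G j x)).
- rewrite (_ : (fun w => _) = (fun w => Num.max (- f w) (- g w))).
    exact: lterm_max.
  by apply/funext => w; rewrite oppr_min.
- rewrite (_ : (fun w => _) = (fun w => Num.min (- f w) (- g w))).
    exact: lterm_min.
  by apply/funext => w; rewrite oppr_max.
Qed.

Lemma lterm_valued A K G P f w : K `<=` A ->
  (forall j x, A x -> A (G j x)) -> lterm K G P f -> valued A w -> A (f w).
Proof.
move=> KA GA + Aw; elim=> [c /KA//|j i _|{}f g _ IHf _ IHg|{}f g _ IHf _ IHg].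
- exact: GA.
- by case: leP.
- by case: leP.
Qed.

(** Any set of reals is closed under binary minima and maxima, since these return one of their
    arguments. *)
Lemma lterm_pred0 K G f : lterm K G pred0 f -> exists2 c, K c & f = fun=> c.
Proof.
elim=> [c Kc|//|{}f g _ [c Kc ->] _ [d Kd ->]|{}f g _ [c Kc ->] _ [d Kd ->]].
- by exists c.
- by exists (Num.min c d) => //; case: leP.
- by exists (Num.max c d) => //; case: leP.
Qed.

Lemma sub_lterm K G P P' f : {subset P <= P'} ->
  lterm K G P f -> lterm K G P' f.
Proof.
move=> PP'; elim=> [c Kc|j i Pi|{}f g _ IHf _ IHg|{}f g _ IHf _ IHg].
- exact: lterm_cst.
- by apply: lterm_lit; exact: PP'.
- exact: lterm_min.
- exact: lterm_max.
Qed.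

Lemma le_foldr_min (T : eqType) (h : T -> R) c s x :
  (x <= foldr (fun l => Num.min (h l)) c s) = (x <= c) && all (fun l => x <= h l) s.
Proof. by elim: s => [|l s IH] /=; rewrite ?andbT// le_min IH andbCA. Qed.

Definition clause G c (s : seq (nat * I)) w : R :=
  foldr (fun l => Num.min (G l.1 (w l.2))) c s.

Lemma clause_cat G c d s t w :
  clause G (Num.min c d) (s ++ t) w = Num.min (clause G c s w) (clause G d t w).
Proof.
apply/eqP; rewrite eq_le; apply/andP; split.
  rewrite le_min !le_foldr_min.
  have := lexx (clause G (Num.min c d) (s ++ t) w).
  rewrite {2}/clause le_foldr_min all_cat le_min => /andP[/andP[-> ->]].
  by move=> /andP[-> ->].
rewrite /clause le_foldr_min all_cat le_min.
have := lexx (clause G c s w); rewrite {2}/clause le_foldr_min => /andP[h1 h2].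
have := lexx (clause G d t w); rewrite {2}/clause le_foldr_min => /andP[h3 h4].
rewrite !ge_min h1 h3 orbT /=.
apply/andP; split; [move: h2|move: h4]; apply: sub_all => l hl;
  by rewrite ge_min hl ?orbT.
Qed.

(** Equality with a maximum of clauses is demanded only on [A]-valued arguments: a literal becomes a
    clause by taking its minimum with [top], which bounds the literals only there. *)
Inductive dnf A K G P f : Prop :=
| dnf_clause c s of K c & all (fun l => P l.2) s &
    (forall w, valued A w -> f w = clause G c s w)
| dnf_max g h of dnf A K G P g & dnf A K G P h &
    (forall w, valued A w -> f w = Num.max (g w) (h w)).

Lemma dnf_min A K G P f g : dnf A K G P f -> dnf A K G P g ->
  dnf A K G P (fun w => Num.min (f w) (g w)).
Proof.
move=> Hf Hg; elim: Hf => {}f.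
  move=> c s Kc Ps fE; elim: Hg => {}g.
    move=> d t Kd Pt gE; apply: (@dnf_clause _ _ _ _ _ (Num.min c d) (s ++ t)).
    - by case: leP.
    - by rewrite all_cat Ps.
    - by move=> w Aw; rewrite clause_cat fE// gE.
  move=> g1 g2 _ IH1 _ IH2 gE; apply: (dnf_max IH1 IH2) => w Aw.
  by rewrite gE// min_maxr.
move=> f1 f2 _ IH1 _ IH2 fE; apply: (dnf_max IH1 IH2) => w Aw.
by rewrite fE// min_maxl.
Qed.

Lemma lterm_dnf A K G P f (top : R) : K top ->
  (forall j x, A x -> G j x <= top) -> lterm K G P f -> dnf A K G P f.
Proof.
move=> Ktop Gtop; elim=> [c Kc|j i Pi|{}f g _ IHf _ IHg|{}f g _ IHf _ IHg].
- exact: (@dnf_clause _ _ _ _ _ c [::]).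
- apply: (@dnf_clause _ _ _ _ _ top [:: (j, i)]) => //=; first by rewrite Pi.
  by move=> w Aw; rewrite /clause/=; apply/esym/min_idPl/Gtop.
- exact: dnf_min.
- exact: (dnf_max IHf IHg).
Qed.

Lemma unif_on_seq A G (js : seq nat) eta : 0 < eta ->
  (forall j, unif_on A (G j)) ->
  exists2 theta : R, 0 < theta & forall j x y, j \in js -> A x -> A y ->
    `|x - y| < theta -> `|G j x - G j y| < eta.
Proof.
move=> eta0 uG; elim: js => [|j js [t t0 H]]; first by exists 1.
have [t' t'0 H'] := uG j _ eta0.
exists (Num.min t t') => [|i x y]; first by rewrite lt_min t0.
rewrite inE lt_min => /orP[/eqP ->|ijs] Ax Ay /andP[xt xt'].
  exact: H'.
exact: H.
Qed.

(** The input about a single atom: the minimum of a constant and of literals of one variable is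
    maximal at some point of [A], with its maximal value in [K]. *)
Definition attained A K G := forall c (js : seq nat), K c ->
  exists u : R, [/\ A u, K (foldr (fun j => Num.min (G j u)) c js) &
    forall x, A x -> foldr (fun j => Num.min (G j x)) c js <=
                     foldr (fun j => Num.min (G j u)) c js].

(* [g] is the supremum of [f] over the coordinates in [P'] but not in [P];
   it is nearly reached at finitely many points, independently of the
   remaining coordinates. *)
Definition sup_elim A P P' f g :=
  (forall w, valued A w -> f w <= g w) /\
  forall eta, 0 < eta -> exists U : seq (I -> R), exists theta : R,
    [/\ 0 < theta, (forall u, List.In u U -> valued A u) &
    forall w0, valued A w0 -> exists2 u, List.In u U &
      forall w, valued A w -> (forall i, P i -> w i = w0 i) ->
        (forall i, P' i -> ~~ P i -> `|w i - u i| < theta) ->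
        g w0 - eta <= f w].

(** In a clause the atoms outside [P] vary independently, so the minimum of the literals of each of
    them is maximized separately. One point [u], collecting the maximizers, then serves for all
    [w0]. *)
Lemma clause_sup_elim A K G P P' c s : A !=set0 -> attained A K G ->
  (forall j, unif_on A (G j)) -> K c -> all (fun l => P' l.2) s ->
  exists2 g, lterm K G P g & sup_elim A P P' (clause G c s) g.
Proof.
move=> A0 att uG Kc P's.
pose js i := [seq l.1 | l <- s & l.2 == i].
have /choice[u uP] : forall i, exists u : R,
    [/\ A u, K (foldr (fun j => Num.min (G j u)) c (js i)) &
    forall x, A x -> foldr (fun j => Num.min (G j x)) c (js i) <=
                     foldr (fun j => Num.min (G j u)) c (js i)].
  by move=> i; exact: att.
(* The constant [c] enters every [kappa i]; being a member of the clause already, it changes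
   nothing. *)
pose kappa i := foldr (fun j => Num.min (G j (u i))) c (js i).
pose g w := foldr (fun l => Num.min (if P l.2 then G l.1 (w l.2)
  else kappa l.2)) c s.
have gP t : lterm K G P (fun w => foldr (fun l => Num.min
    (if P l.2 then G l.1 (w l.2) else kappa l.2)) c t).
  elim: t => [|l t IH] /=; first exact: lterm_cst.
  case: (boolP (P l.2)) => Pl; apply: lterm_min => //; first exact: lterm_lit.
  by apply: lterm_cst; have [] := uP l.2.
exists g; first exact: gP.
split=> [w Aw|eta eta0].
  rewrite /g le_foldr_min.
  have := lexx (clause G c s w).
  rewrite {2}/clause le_foldr_min => /andP[-> /allP h] /=.
  apply/allP => l ls; case: ifPn => Pl; first exact: h.
  have [_ _ /(_ _ (Aw l.2))] := uP l.2; apply: le_trans.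
  rewrite le_foldr_min; have := lexx (clause G c s w).
  rewrite {2}/clause le_foldr_min => /andP[-> _] /=; apply/allP => j.
  by move=> /mapP[[j' i']]; rewrite mem_filter /= => /andP[/eqP <- /h/=] + ->.
have [theta theta0 thetaP] := unif_on_seq [seq l.1 | l <- s] eta0 uG.
exists [:: u], theta; split => // [v [<-|//] i|w0 Aw0]; first by have [] := uP i.
exists u => [|w Aw ww0 wu]; first by left.
have := lexx (g w0); rewrite {2}/g le_foldr_min => /andP[h0 /allP h].
rewrite /clause le_foldr_min; apply/andP; split.
  by rewrite lerBlDr (le_trans h0)// lerDl ltW.
apply/allP => l ls; have := h _ ls; case: ifPn => Pl.
  by rewrite ww0// => gG; rewrite lerBlDr (le_trans gG)// lerDl ltW.
move=> gk.
have kG : kappa l.2 <= G l.1 (u l.2).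
  have := lexx (kappa l.2); rewrite {2}/kappa le_foldr_min => /andP[_ /allP].
  by apply; apply/mapP; exists l => //; rewrite mem_filter eqxx.
have [Aul _ _] := uP l.2.
have := thetaP l.1 (w l.2) (u l.2) (map_f _ ls) (Aw _) Aul
  (wu _ (allP P's _ ls) Pl).
by rewrite ltr_distl => /andP[/ltW + _]; apply: le_trans; rewrite lerB// (le_trans gk).
Qed.

(** Suprema commute with maxima, so the normal form reduces the claim to clauses. The near-maximal
    points of both disjuncts are kept; [w0] decides which disjunct is the larger and hence which
    point is used. *)
Lemma lterm_sup_elim A K G P P' f (top : R) : A !=set0 ->
  K top -> (forall j x, A x -> G j x <= top) ->
  attained A K G -> (forall j, unif_on A (G j)) -> lterm K G P' f ->
  exists2 g, lterm K G P g & sup_elim A P P' f g.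
Proof.
move=> A0 Ktop Gtop att uG /(lterm_dnf Ktop Gtop).
elim=> {}f => [c s Kc Ps fE|f1 f2 _ [g1 Kg1 [le1 ap1]] _ [g2 Kg2 [le2 ap2]] fE].
  have [g Kg [le_fg ap]] := @clause_sup_elim _ _ _ P _ _ _ A0 att uG Kc Ps.
  exists g => //; split=> [w Aw|eta /ap[U [theta [theta0 AU H]]]].
    by rewrite fE// le_fg.
  exists U, theta; split=> // w0 /H[u uU Hu]; exists u => // w Aw ww0 wu.
  by rewrite fE//; exact: Hu.
exists (fun w => Num.max (g1 w) (g2 w)); first exact: lterm_max.
split=> [w Aw|eta eta0].
  by rewrite fE// ge_max !le_max le1// le2// orbT.
have [U1 [t1 [t10 AU1 H1]]] := ap1 _ eta0.
have [U2 [t2 [t20 AU2 H2]]] := ap2 _ eta0.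
exists (U1 ++ U2), (Num.min t1 t2); split.
- by rewrite lt_min t10.
- by move=> u uU; have [/AU1|/AU2] := List.in_app_or _ _ _ uU.
- move=> w0 Aw0; have [g12|g21] := leP (g1 w0) (g2 w0).
    have [u uU Hu] := H2 _ Aw0; exists u; first by apply: List.in_or_app; right.
    move=> w Aw ww0 wu; rewrite fE// le_max Hu ?orbT// => i P'i Pi.
    by have := wu i P'i Pi; rewrite lt_min => /andP[].
  have [u uU Hu] := H1 _ Aw0; exists u; first by apply: List.in_or_app; left.
  move=> w Aw ww0 wu; rewrite fE// le_max Hu// => i P'i Pi.
  by have := wu i P'i Pi; rewrite lt_min => /andP[].
Qed.

End lattice_terms.

(** * Quantifier elimination *)

Section finite_extrema.
Context {R : realType} {n : nat}.
Implicit Types h : 'I_n.+1 -> R.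

Lemma sup_range_ord h :
  exists a, sup (range h) = h a /\ forall b, h b <= h a.
Proof.
have [a _ ha] := @Order.TotalTheory.arg_maxP _ _ _ ord0 xpredT h isT.
exists a; split=> [|b]; last exact: ha.
apply/eqP; rewrite eq_le; apply/andP; split.
  by apply: ge_sup => [|_ [b _ <-]]; [exists (h a), a|exact: ha].
by apply: ub_le_sup; [exists (h a) => _ [b _ <-]; exact: ha|exists a].
Qed.

Lemma inf_range_opp h : inf (range h) = - sup (range (fun a => - h a)).
Proof. by rewrite /inf image_comp. Qed.

End finite_extrema.

(** * Extension axioms and approximation of values *)

Section structures.
Context {R : realType} {Rel : finType} {ar : Rel -> nat}.
Local Notation I := {r : Rel & (ar r).-tuple nat}.
Local Notation interp n := (interpretation R ar 'I_n.+1).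
Implicit Types (A K : set R) (neg : R -> R) (f : (I -> R) -> R).

(** An element of [I] is an atom over positions: the number [y] stands for the [y]-th entry of a
    list of points, counted from [0]. *)
Definition level k (i : I) : bool := all (fun y => (y < k)%N) (tagged i).

(** The default [ord0] is read only at positions beyond the end of [e], which atoms of level
    [size e] do not mention. *)
Definition diagram n (M : interp n) (e : seq 'I_n.+1) (i : I) : R :=
  M (tag i) (map_tuple (nth ord0 e) (tagged i)).

Definition interp_valued A n (M : interp n) := forall r xs, A (M r xs).

(** Approximate version of the extension axioms of finite model theory. The new point has position
    [k], and exactly the atoms over the first [k.+1] positions that mention it are prescribed. *)
Definition extension_axiom n (M : interp n) k (u : I -> R) (theta : R) :=
  forall e : seq 'I_n.+1, uniq e -> size e = k -> exists2 b, b \notin e &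
    forall i, level k.+1 i -> ~~ level k i ->
      `|diagram M (rcons e b) i - u i| < theta.

(* [Q] follows from finitely many extension axioms, uniformly in [n]. *)
Definition asym A (Q : forall n, interp n -> Prop) :=
  exists2 L : seq (nat * (I -> R) * R),
    forall x, List.In x L -> valued A x.1.2 /\ 0 < x.2 &
    forall n (M : interp n), interp_valued A M ->
      (forall x, List.In x L -> extension_axiom M x.1.1 x.1.2 x.2) -> Q n M.

(** [v] sends variables to positions in [e]. The extension axioms behind [asym] may depend on [eta],
    but not on the structure or on [e]. *)
Definition approx A k (g : forall n, interp n -> (nat -> 'I_n.+1) -> R)
    (v : nat -> nat) f :=
  forall eta, 0 < eta -> asym A (fun n M => forall e, uniq e -> size e = k ->
    `|g n M (fun y => nth ord0 e (v y)) - f (diagram M e)| <= eta).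

Section asym.
Context (A : set R).
Implicit Types Q : forall n, interp n -> Prop.

Lemma asymW Q Q' :
  (forall n (M : interp n), interp_valued A M -> Q n M -> Q' n M) ->
  asym A Q -> asym A Q'.
Proof. by move=> QQ' [L AL H]; exists L => // n M AM ML; exact/QQ'/H. Qed.

Lemma asymT Q : (forall n (M : interp n), interp_valued A M -> Q n M) -> asym A Q.
Proof. by move=> HQ; exists [::] => // n M AM _; exact: HQ. Qed.

Lemma asymI Q Q' : asym A Q -> asym A Q' -> asym A (fun n M => Q n M /\ Q' n M).
Proof.
move=> [L AL H] [L' AL' H']; exists (L ++ L').
  by move=> x xL; have [/AL|/AL'] := List.in_app_or _ _ _ xL.
move=> n M AM ML; split.
  by apply: H => // x xL; apply: ML; apply: List.in_or_app; left.
by apply: H' => // x xL; apply: ML; apply: List.in_or_app; right.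
Qed.

Lemma asym_extension k u theta : valued A u -> 0 < theta ->
  asym A (fun n M => extension_axiom M k u theta).
Proof.
move=> Au theta0; exists [:: (k, u, theta)] => [x [<-|]//|n M AM ML].
by apply: (ML (k, u, theta)); left.
Qed.

Lemma asym_ltn m (Q : nat -> forall n, interp n -> Prop) :
  (forall i, (i < m)%N -> asym A (Q i)) ->
  asym A (fun n M => forall i, (i < m)%N -> Q i n M).
Proof.
elim: m => [|m IH] H; first exact: asymT.
apply: asymW (asymI (IH _) (H m (leqnn _))) => [n M AM [h hm] i|i im].
  by rewrite ltnS leq_eqVlt => /orP[/eqP ->//|]; exact: h.
by apply: H; exact: ltnW.
Qed.

Lemma asym_In T (s : seq T) (Q : T -> forall n, interp n -> Prop) :
  (forall x, List.In x s -> asym A (Q x)) ->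
  asym A (fun n M => forall x, List.In x s -> Q x n M).
Proof.
elim: s => [|a s IH] H; first exact: asymT.
apply: asymW (asymI (IH _) (H a _)) => [n M AM [h ha] x [<-//|]|x xs|].
- exact: h.
- by apply: H; right.
- by left.
Qed.

End asym.

Lemma diagram_valued A n (M : interp n) e :
  interp_valued A M -> valued A (diagram M e).
Proof. by move=> AM i; exact: AM. Qed.

Lemma diagram_rcons n (M : interp n) e b i : level (size e) i ->
  diagram M (rcons e b) i = diagram M e i.
Proof.
move=> /allP li; rewrite /diagram; congr (M _ _); apply: eq_from_tnth => j.
by rewrite !tnth_map nth_rcons li// mem_tnth.
Qed.

Lemma value_eq_free neg n (M : interp n) phi v v' :
  {in free_vars phi, v =1 v'} -> value neg M v phi = value neg M v' phi.
Proof.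
elim: phi v v' => [r xs|f IHf g IHg|f IHf g IHg|f IHf|x f IHf|x f IHf] v v' /= vv'.
- by congr (M _ _); apply: eq_from_tnth => j; rewrite !tnth_map vv'// mem_tnth.
- by rewrite (IHf v v') ?(IHg v v')// => y yf; apply: vv';
    rewrite mem_cat yf ?orbT.
- by rewrite (IHf v v') ?(IHg v v')// => y yf; apply: vv';
    rewrite mem_cat yf ?orbT.
- by rewrite (IHf v v').
- suff -> : (fun a => value neg M (update v x a) f) =
           (fun a => value neg M (update v' x a) f) by [].
  apply/funext => a; apply: IHf => y yf.
  by rewrite /update; case: eqVneq => // yx; apply: vv'; rewrite mem_filter yx.
- suff -> : (fun a => value neg M (update v x a) f) =
           (fun a => value neg M (update v' x a) f) by [].
  apply/funext => a; apply: IHf => y yf.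
  by rewrite /update; case: eqVneq => // yx; apply: vv'; rewrite mem_filter yx.
Qed.

Lemma value_in A neg n (M : interp n) v phi :
  (forall x, A x -> A (neg x)) -> interp_valued A M -> A (value neg M v phi).
Proof.
move=> Aneg AM; elim: phi v => [r xs|f IHf g IHg|f IHf g IHg|f IHf|x f IHf|x f IHf] v /=.
- exact: AM.
- by case: leP.
- by case: leP.
- exact: Aneg.
- rewrite inf_range_opp.
  have [a [-> _]] := sup_range_ord (fun a => - value neg M (update v x a) f).
  by rewrite opprK.
- by have [a [-> _]] := sup_range_ord (fun a => value neg M (update v x a) f).
Qed.

(* Quantifier elimination for one existential quantifier: the witness is either
   one of the [k] named points or, by an extension axiom, a new one. *)
Lemma approx_sup A K G top k x (fv : seq nat) (v : nat -> nat)
    (g : forall n, interp n -> (nat -> 'I_n.+1) -> R) :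
  A !=set0 -> K top -> (forall j x, A x -> G j x <= top) ->
  attained A K G -> (forall j, unif_on A (G j)) ->
  (forall n (M : interp n) a a', {in fv, a =1 a'} -> g n M a = g n M a') ->
  (forall y, y \in fv -> y != x -> (v y < k)%N) ->
  (forall i, (i < k)%N -> exists2 f, lterm K G (level k) f &
     approx A k g (update v x i) f) ->
  (exists2 f, lterm K G (level k.+1) f & approx A k.+1 g (update v x k) f) ->
  exists2 f, lterm K G (level k) f &
    approx A k (fun n M a => sup (range (fun b => g n M (update a x b)))) v f.
Proof.
move=> A0 Ktop Gtop att uG gfree vk Hold [fn Kfn apn].
(* [fn] is a dummy value of [F] for [i] outside the range. *)
have /choice[F FP] : forall i, exists f, (i < k)%N ->
    lterm K G (level k) f /\ approx A k g (update v x i) f.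
  move=> i; have [/Hold[f Kf apf]|] := boolP (i < k)%N; first by exists f.
  by exists fn.
have [fe Kfe [fn_le fe_near]] :=
  lterm_sup_elim (level k) A0 Ktop Gtop att uG Kfn.
(* The witness is an old point, accounted for by [F i], or a new one, whose term [fn] has been freed
   of position [k] in [fe]. *)
pose f w := \big[Num.max/fe w]_(i < k) F i w.
have Kf : lterm K G (level k) f.
  rewrite /f; pose s := index_enum 'I_k; rewrite -/s.
  elim: s => [|i s IH].
    rewrite (_ : (fun w => _) = fe)//.
    by apply/funext => w; rewrite big_nil.
  rewrite (_ : (fun w => _) = (fun w => Num.max (F i w)
    (\big[Num.max/fe w]_(i <- s) F i w))).
    by apply: lterm_max => //; have [] := FP _ (ltn_ord i).
  by apply/funext => w; rewrite big_cons.
have fe_f w : fe w <= f w by rewrite /f; exact: bigmax_ge_id.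
have F_f w i : (i < k)%N -> F i w <= f w.
  by move=> ik; rewrite /f (bigmax_sup (Ordinal ik)).
have f_cases w : f w = fe w \/ exists2 i, (i < k)%N & f w = F i w.
  rewrite /f; apply: (big_ind (fun z => z = fe w \/ exists2 i, (i < k)%N & z = F i w)).
  - by left.
  - by move=> y z Hy Hz; case: leP.
  - by move=> i _; right; exists i.
exists f => // eta eta0.
(* Half of [eta] is spent on approximating the values at new points by [fn], half on nearly reaching
   [fe]. *)
have eta20 : 0 < eta / 2 by rewrite divr_gt0.
have [U [theta [theta0 AU HU]]] := fe_near _ eta20.
have Hext : asym A (fun n (M : interp n) =>
    forall u, List.In u U -> extension_axiom M k u theta).
  by apply: asym_In => u uU; apply: asym_extension => //; exact: AU.
have HF : asym A (fun n (M : interp n) => forall i, (i < k)%N ->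
    forall e, uniq e -> size e = k ->
    `|g n M (fun y => nth ord0 e (update v x i y)) - F i (diagram M e)| <= eta).
  by apply: asym_ltn => i ik; have [_] := FP _ ik; apply.
apply: asymW (asymI HF (asymI (apn _ eta20) Hext)).
move=> n M AM [{}HF [Hn {}Hext]] e ue ek.
set a := fun y => nth ord0 e (v y).
have old i : (i < k)%N ->
    g n M (update a x (nth ord0 e i)) =
    g n M (fun y => nth ord0 e (update v x i y)).
  by move=> ik; congr (g n M); apply/funext => y; rewrite /update; case: eqP.
have new b : g n M (update a x b) =
    g n M (fun y => nth ord0 (rcons e b) (update v x k y)).
  apply: gfree => y yfv; rewrite /update /a; case: eqVneq => [_|yx].
    by rewrite nth_rcons ek ltnn eqxx.
  by rewrite nth_rcons ek vk.
have Dn b : valued A (diagram M (rcons e b)) by exact: diagram_valued.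
have De b i : level k i -> diagram M (rcons e b) i = diagram M e i.
  by rewrite -ek; exact: diagram_rcons.
have fe_e b : fe (diagram M (rcons e b)) = fe (diagram M e).
  elim: Kfe => [//|j i Pi|h h' _ -> _ -> //|h h' _ -> _ -> //].
  by rewrite De.
have gnew b : b \notin e ->
    `|g n M (update a x b) - fn (diagram M (rcons e b))| <= eta / 2.
  by move=> be; rewrite new Hn ?size_rcons ?ek// rcons_uniq be.
have [b [-> bmax]] := sup_range_ord (fun b => g n M (update a x b)).
rewrite ler_distl; apply/andP; split; last first.
  (* Upper bound: an old maximizer [b] is covered by some [F i], a new one by [fn <= fe]. *)
  have [be|be] := boolP (b \in e).
    have ik : (index b e < k)%N by rewrite -ek index_mem.
    have := HF _ ik e ue ek; rewrite -old// nth_index// ler_distl.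
    by move=> /andP[_ /le_trans]; apply; rewrite lerD2r F_f.
  have := gnew _ be; rewrite ler_distl => /andP[_ /le_trans]; apply.
  apply: lerD; last by rewrite ler_pdivrMr// ler_pMr// ler1n.
  by rewrite (le_trans (fn_le _ (Dn b)))// fe_e.
(* Lower bound: [f] equals some [F i], and the old point in position [i] suffices, or it equals
   [fe], and an extension axiom yields a new point [c] at which [fn] almost reaches [fe]. *)
have [->|[i ik ->]] := f_cases (diagram M e); last first.
  have := HF _ ik e ue ek; rewrite -old// ler_distl => /andP[h _].
  exact: le_trans h (bmax _).
have [u uU Hu] := HU _ (diagram_valued e AM).
have [c ce Hc] := Hext _ uU e ue ek.
apply: le_trans (bmax c).
have := gnew _ ce; rewrite ler_distl => /andP[+ _]; apply: le_trans.
suff : fe (diagram M e) - eta / 2 <= fn (diagram M (rcons e c)) by lra.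
by apply: Hu => // i; exact: De.
Qed.

End structures.

(** * Quantifier elimination for all formulas *)

Section quantifier_elimination.
Context {R : realType} {Rel : finType} {ar : Rel -> nat}.
Context (A K : set R) (neg : R -> R).
Context (A01 : A `<=` `[0, 1]).
Context (KA : K `<=` A) (K0 : K 0) (K1 : K 1).
Context (A_neg : forall x, A x -> A (neg x)).
Context (K_neg : forall x, K x -> K (neg x)).
Context (neg_unif : unif_on A neg).
Context (neg_min : forall v w, A v -> A w ->
    neg (Num.min v w) = Num.max (neg v) (neg w)).
Context (neg_max : forall v w, A v -> A w ->
    neg (Num.max v w) = Num.min (neg v) (neg w)).
Local Notation G := (fun j => iter j neg).
Local Notation NG := (fun j x => - iter j neg x).
Local Notation NK := [set - x | x in K].
Context (att_sup : attained A K G) (att_inf : attained A NK NG).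

Lemma iter_neg_in j x : A x -> A (iter j neg x).
Proof. by move=> Ax; elim: j => //= j; exact: A_neg. Qed.

Lemma iter_neg_unif j : unif_on A (iter j neg).
Proof.
elim: j => [|j IH]; first by move=> eta eta0; exists eta.
by apply: unif_on_comp IH => // x; exact: iter_neg_in.
Qed.

(** De Morgan's laws push the negation down to the literals, where it raises the iterate by one, and
    to the constants, which [neg] keeps in [K]. *)
Lemma lterm_neg (I : eqType) (P : pred I) f : lterm K G P f ->
  exists2 g, lterm K G P g & forall w, valued A w -> g w = neg (f w).
Proof.
have lA (h : (I -> R) -> R) w : lterm K G P h -> valued A w -> A (h w).
  by apply: lterm_valued => // j x; exact: iter_neg_in.
elim=> [c Kc|j i Pi|f1 f2 K1' [g1 Kg1 E1] K2 [g2 Kg2 E2]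
               |f1 f2 K1' [g1 Kg1 E1] K2 [g2 Kg2 E2]].
- by exists (fun=> neg c) => //; exact/lterm_cst/K_neg.
- by exists (fun w => iter j.+1 neg (w i)) => //; exact: lterm_lit.
- exists (fun w => Num.max (g1 w) (g2 w)); first exact: lterm_max.
  by move=> w Aw; rewrite neg_min ?E1 ?E2//; exact: lA.
- exists (fun w => Num.min (g1 w) (g2 w)); first exact: lterm_min.
  by move=> w Aw; rewrite neg_max ?E1 ?E2//; exact: lA.
Qed.

(** By induction on the formula, for all [k] and [v], since a quantifier gives position [k] to a new
    point. Errors pass through minima and maxima without growing, and through [neg] by uniform
    continuity. *)
Lemma approx_value (phi : formula ar) k (v : nat -> nat) :
  (forall y, y \in free_vars phi -> (v y < k)%N) ->
  exists2 f, lterm K G (level k) f &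
    approx A k (fun n M a => value neg M a phi) v f.
Proof.
have A_0 : A !=set0 by exists 0; exact: KA.
have G1 j x : A x -> iter j neg x <= 1.
  by move=> /(iter_neg_in j)/A01; rewrite /= in_itv/= => /andP[].
have NG0 j x : A x -> - iter j neg x <= 0.
  by move=> /(iter_neg_in j)/A01; rewrite /= in_itv/= oppr_le0 => /andP[].
elim: phi k v => [r xs|phi IH psi IH'|phi IH psi IH'|phi IH|x phi IH|x phi IH] k v /= vk.
- have lv : level k (existT _ r (map_tuple v xs) : {r : Rel & (ar r).-tuple nat}).
    by apply/allP => _ /mapP[y yx ->]; exact: vk.
  exists (fun w => iter 0 neg (w (existT _ r (map_tuple v xs)))).
    exact: (lterm_lit _ (fun j => iter j neg)).
  move=> eta eta0; apply: asymT => n M AM e _ _ /=.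
  rewrite /diagram/= (_ : map_tuple _ (map_tuple v xs) =
    map_tuple (fun y => nth ord0 e (v y)) xs) ?subrr ?normr0 ?ltW//.
  by apply: eq_from_tnth => j; rewrite !tnth_map.
- have [f Kf apf] : exists2 f, lterm K G (level k) f &
      approx A k (fun n M a => value neg M a phi) v f.
    by apply: IH => y yf; apply: vk; rewrite mem_cat yf.
  have [g Kg apg] : exists2 f, lterm K G (level k) f &
      approx A k (fun n M a => value neg M a psi) v f.
    by apply: IH' => y yf; apply: vk; rewrite mem_cat yf orbT.
  exists (fun w => Num.min (f w) (g w)); first exact: lterm_min.
  move=> eta eta0; apply: asymW (asymI (apf _ eta0) (apg _ eta0)).
  by move=> n M AM [hf hg] e ue ek; apply: ler_dist_min; [exact: hf|exact: hg].
- have [f Kf apf] : exists2 f, lterm K G (level k) f &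
      approx A k (fun n M a => value neg M a phi) v f.
    by apply: IH => y yf; apply: vk; rewrite mem_cat yf.
  have [g Kg apg] : exists2 f, lterm K G (level k) f &
      approx A k (fun n M a => value neg M a psi) v f.
    by apply: IH' => y yf; apply: vk; rewrite mem_cat yf orbT.
  exists (fun w => Num.max (f w) (g w)); first exact: lterm_max.
  move=> eta eta0; apply: asymW (asymI (apf _ eta0) (apg _ eta0)).
  by move=> n M AM [hf hg] e ue ek; apply: ler_dist_max; [exact: hf|exact: hg].
- have [f Kf apf] := IH k v vk.
  have [g Kg gE] := lterm_neg Kf.
  exists g => // eta eta0; have [theta theta0 H] := neg_unif eta0.
  have theta20 : 0 < theta / 2 by rewrite divr_gt0.
  apply: asymW (apf _ theta20) => n M AM h e ue ek.
  have AD := diagram_valued e AM.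
  rewrite gE//; apply/ltW/H.
  + exact: value_in.
  + by apply: lterm_valued Kf AD => // j y; exact: iter_neg_in.
  + by rewrite (le_lt_trans (h e ue ek))// ltr_pdivrMr// ltr_pMr// ltr1n.
- have upd i k' : (i < k')%N -> (k <= k')%N ->
      forall y, y \in free_vars phi -> (update v x i y < k')%N.
    move=> ik' kk' y yf; rewrite /update; case: eqVneq => // yx.
    by rewrite (leq_trans _ kk')// vk// mem_filter yx.
  (* An infimum is minus a supremum: the elimination is applied to the values with changed sign,
     with literals [NG] and constants [NK], and the signs are changed back at the end. *)
  have Nap k' v' f : approx A k' (fun n M a => value neg M a phi) v' f ->
      approx A k' (fun n M a => - value neg M a phi) v' (fun w => - f w).
    move=> apf eta eta0; apply: asymW (apf _ eta0) => n M AM h e ue ek.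
    by rewrite -opprD normrN; exact: h.
  have NK0 : NK 0 by exists 0 => //; rewrite oppr0.
  have NGunif j : unif_on A (NG j).
    move=> eta /(iter_neg_unif j)[theta theta0 H]; exists theta => // y z Ay Az yz.
    by rewrite -opprD normrN; exact: H.
  have [] := @approx_sup _ _ _ A NK NG 0 k x (free_vars phi) v
     (fun n M a => - value neg M a phi) A_0 NK0 NG0 att_inf NGunif.
  + by move=> n M a a' aa'; rewrite (value_eq_free _ _ aa').
  + by move=> y yf yx; apply: vk; rewrite mem_filter yx.
  + move=> i ik; have [f Kf apf] := IH k (update v x i) (upd i k ik (leqnn _)).
    by exists (fun w => - f w); [exact: lterm_opp|exact: Nap].
  + have [f Kf apf] := IH k.+1 (update v x k) (upd k _ (leqnn _) (leqnSn _)).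
    by exists (fun w => - f w); [exact: lterm_opp|exact: Nap].
  move=> f /lterm_opp Kf apf; exists (fun w => - f w).
    rewrite (_ : [set - x | x in NK] = K) in Kf; last first.
      apply/seteqP; split=> [_ [_ [y Ky <-] <-]|y Ky]; first by rewrite opprK.
      by exists (- y); [exists y|rewrite opprK].
    rewrite (_ : (fun j y => - - iter j neg y) = G) in Kf => //.
    by apply/funext => j; apply/funext => y; rewrite opprK.
  move=> eta eta0; apply: asymW (apf _ eta0) => n M AM h e ue ek.
  by rewrite inf_range_opp -opprD normrN; exact: h.
- have upd i k' : (i < k')%N -> (k <= k')%N ->
      forall y, y \in free_vars phi -> (update v x i y < k')%N.
    move=> ik' kk' y yf; rewrite /update; case: eqVneq => // yx.
    by rewrite (leq_trans _ kk')// vk// mem_filter yx.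
  apply: (@approx_sup _ _ _ A K G 1 k x (free_vars phi) v
     (fun n M a => value neg M a phi)) => //.
  + exact: iter_neg_unif.
  + by move=> n M a a' aa'; rewrite (value_eq_free _ _ aa').
  + by move=> y yf yx; apply: vk; rewrite mem_filter yx.
  + by move=> i ik; exact: IH (upd i k ik (leqnn _)).
  + exact: IH (upd k _ (leqnn _) (leqnSn _)).
Qed.

(** With [k = 0] no position is available, whereas an atom of positive arity mentions one; so the
    term contains no atoms and is constant. *)
Lemma approx_sentence (ar_gt0 : forall r, (0 < ar r)%N) (phi : formula ar) : sentence phi ->
  exists2 c, K c & forall eta, 0 < eta -> asym A (fun n M =>
    `|value neg M (fun=> ord0) phi - c| <= eta).
Proof.
move=> sphi.
have [|f Kf apf] := @approx_value phi 0 (fun=> 0%N).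
  by move=> y; rewrite (sphi : free_vars phi = [::]).
have [|c Kc fE] := @lterm_pred0 _ _ K G f.
  apply: sub_lterm Kf => -[r xs]; rewrite unfold_in /level /=.
  have := ar_gt0 r; rewrite -[X in (0 < X)%N](size_tuple xs).
  by case: (tval xs).
exists c => // eta eta0; apply: asymW (apf _ eta0) => n M AM /(_ [::] isT erefl).
by rewrite fE.
Qed.

End quantifier_elimination.

(** * Independence in finite products *)

Section real_probability.
Context d (T : measurableType d) (R : realType) (P : probability T R).

Definition pr (X : set T) : R := fine (P X).

Lemma prE X : measurable X -> P X = (pr X)%:E.
Proof. by move=> mX; rewrite /pr fineK// fin_num_measure. Qed.

Lemma pr_ge0 X : 0 <= pr X.
Proof. by rewrite fine_ge0. Qed.

Lemma pr_le1 X : measurable X -> pr X <= 1.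
Proof. by move=> mX; rewrite -lee_fin -prE// probability_le1. Qed.

Lemma prT : pr setT = 1.
Proof. by rewrite /pr probability_setT. Qed.

Lemma le_pr X Y : measurable X -> measurable Y -> X `<=` Y -> pr X <= pr Y.
Proof.
by move=> mX mY XY; rewrite -lee_fin -!prE//; apply: le_measure; rewrite ?inE.
Qed.

Lemma prD X Y : measurable X -> measurable Y ->
  pr (X `\` Y) = pr X - pr (X `&` Y).
Proof.
move=> mX mY; apply: EFin_inj; rewrite EFinB -!prE.
- by rewrite measureD//; exact: le_lt_trans (probability_le1 P mX) (ltry _).
- exact: measurableI.
- by [].
- exact: measurableD.
Qed.

Lemma prC X : measurable X -> pr (~` X) = 1 - pr X.
Proof. by move=> mX; rewrite -setTD prD// setTI prT. Qed.

Lemma prU_le X Y : measurable X -> measurable Y -> pr (X `|` Y) <= pr X + pr Y.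
Proof.
move=> mX mY; rewrite -lee_fin EFinD -!prE//; first exact: measureU2.
exact: measurableU.
Qed.

Lemma pr_bigU_le J (s : seq J) (F : J -> set T) (c : R) :
  (forall j, measurable (F j)) -> (forall j, pr (F j) <= c) ->
  pr (\big[setU/set0]_(j <- s) F j) <= c *+ size s.
Proof.
move=> mF Fc; elim: s => [|j s IH]; first by rewrite big_nil /pr measure0.
rewrite big_cons mulrS (le_trans (prU_le _ _))//; last exact: lerD.
exact: bigsetU_measurable.
Qed.

End real_probability.

(** * Independence of events that constrain different coordinates *)

Section product_independence.
Context d (T : measurableType d) (R : realType) (N : nat).
Context (P : 'I_N -> probability T R).
Local Notation Pr := (pr (product_probability P)).
Implicit Types B C : 'I_N -> set T.

Definition rect B := [set t : N.-tuple T | forall i, B i (tnth t i)].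

Lemma measurable_rect B : (forall i, measurable (B i)) -> measurable (rect B).
Proof.
move=> mB; rewrite (_ : rect B = \big[setI/setT]_(i < N)
    ((fun t : N.-tuple T => tnth t i) @^-1` B i)).
  apply: bigsetI_measurable => i _.
  by rewrite -[X in measurable X]setTI; exact: measurable_tnth.
rewrite -bigcap_seq; apply/seteqP; split=> t /= tB i; first by move=> _; exact: tB.
by apply: tB; rewrite /= mem_index_enum.
Qed.

Lemma pr_rect B : (forall i, measurable (B i)) ->
  Pr (rect B) = \prod_i pr (P i) (B i).
Proof.
move=> mB; rewrite /pr /rect product_probability_rect//.
by rewrite (eq_bigr (fun i => (pr (P i) (B i))%:E)) ?prodEFin// => i _; exact: prE.
Qed.

Definition indep B C := forall i, B i = setT \/ C i = setT.

Lemma rectI B C : rect B `&` rect C = rect (fun i => B i `&` C i).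
Proof.
apply/seteqP; split=> t /=; first by move=> [tB tC] i; split; [exact: tB|exact: tC].
by move=> tBC; split=> i; have [] := tBC i.
Qed.

Lemma pr_rectI B C : (forall i, measurable (B i)) ->
  (forall i, measurable (C i)) -> indep B C ->
  Pr (rect B `&` rect C) = Pr (rect B) * Pr (rect C).
Proof.
move=> mB mC BC; rewrite rectI !pr_rect//; last by move=> i; exact: measurableI.
rewrite -big_split; apply: eq_bigr => i _ /=.
by have [->|->] := BC i; rewrite ?setTI ?setIT prT ?mul1r ?mulr1.
Qed.

Definition avoid (J : Type) (B : J -> 'I_N -> set T) (s : seq J) :=
  foldr (fun b X => X `\` rect (B b)) setT s.

Lemma measurable_avoid (J : Type) (B : J -> 'I_N -> set T) s :
  (forall b i, measurable (B b i)) -> measurable (avoid B s).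
Proof.
move=> mB; elim: s => [|b s IH] /=; first exact: measurableT.
by apply: measurableD => //; exact: measurable_rect.
Qed.

Lemma avoidP (J : eqType) (B : J -> 'I_N -> set T) s t :
  ~ avoid B s t -> exists2 b, b \in s & rect (B b) t.
Proof.
elim: s => [/(_ I)//|b s IH] /= nBt.
have [Bt|Bt] := pselect (rect (B b) t); first by exists b; rewrite ?mem_head.
have /IH[c cs Ct] : ~ avoid B s t by move=> h; exact: nBt.
by exists c; rewrite // inE cs orbT.
Qed.

(** Independence of the events [rect (B b)] passes to their complements. The extra rectangle
    [rect C] makes the induction work: removing [rect (B b)] leaves a difference of two terms of the
    same kind, for [C] and for its intersection with [B b]. *)
Lemma pr_avoid (J : eqType) (B : J -> 'I_N -> set T) (s : seq J) C :
  (forall b i, measurable (B b i)) ->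
  {in s &, forall b b', b != b' -> indep (B b) (B b')} -> uniq s ->
  (forall i, measurable (C i)) -> {in s, forall b, indep C (B b)} ->
  Pr (rect C `&` avoid B s) =
    Pr (rect C) * \prod_(b <- s) (1 - Pr (rect (B b))).
Proof.
move=> mB; elim: s C => [|b s IH] C indB /=.
  by move=> _ _ _; rewrite setIT big_nil mulr1.
move=> /andP[bs us] mC CB; rewrite setIDA prD; first last.
- exact: measurable_rect.
- by apply: measurableI; [exact: measurable_rect|exact: measurable_avoid].
have indB' : {in s &, forall b b', b != b' -> indep (B b) (B b')}.
  by move=> x y xs ys; apply: indB; rewrite inE ?xs ?ys orbT.
rewrite setIAC rectI IH//; last first.
  by move=> c cs; apply: CB; rewrite inE cs orbT.
rewrite IH//; last 2 first.
- by move=> i; exact: measurableI.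
- move=> c cs i; have cbs : c \in b :: s by rewrite inE cs orbT.
  have bc : b != c by apply: contraNneq bs => ->.
  have [->|->] := CB c cbs i; last by right.
  by have [->|->] := indB b c (mem_head _ _) cbs bc i; [left; rewrite setTI|right].
rewrite -rectI pr_rectI//; last by apply: CB; exact: mem_head.
rewrite big_cons; ring.
Qed.

Lemma pr_avoid_le (J : eqType) (B : J -> 'I_N -> set T) (s : seq J) (q : R) :
  (forall b i, measurable (B b i)) ->
  {in s &, forall b b', b != b' -> indep (B b) (B b')} -> uniq s ->
  {in s, forall b, q <= Pr (rect (B b))} -> Pr (avoid B s) <= (1 - q) ^+ size s.
Proof.
move=> mB indB us qB.
have rT : rect (fun=> setT) = setT by apply/seteqP; split.
have := @pr_avoid _ B s (fun=> setT) mB indB us (fun=> measurableT).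
rewrite rT prT setTI mul1r => ->; last by move=> b _ i; left.
elim: s {indB us} qB => [|b s IH] qB; first by rewrite big_nil.
rewrite big_cons exprS ler_pM//.
- by rewrite subr_ge0 pr_le1//; exact: measurable_rect.
- apply: prodr_ge0 => c _.
  by rewrite subr_ge0 pr_le1//; exact: measurable_rect.
- by rewrite lerB// qB// mem_head.
- by apply: IH => c cs; apply: qB; rewrite inE cs orbT.
Qed.

End product_independence.

(** * Polynomial growth against geometric decay *)

Section polynomial_times_geometric.
Context {R : realType}.
Implicit Types x y h : R.

Lemma bernoulli_le h n : -1 <= h -> 1 + h *+ n <= (1 + h) ^+ n.
Proof.
move=> h1; elim: n => [|n IH]; first by rewrite mulr0n addr0 expr0.
rewrite exprS; apply: le_trans (ler_wpM2l _ IH); last lra.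
rewrite mulrS -mulr_natr; have : 0 <= h * h * n%:R by rewrite mulr_ge0// -expr2 sqr_ge0.
lra.
Qed.

Lemma cvg_poly_geometric x k : 0 < x -> x < 1 ->
  (n%:R ^+ k * x ^+ n : R) @[n --> \oo] --> (0 : R).
Proof.
move=> x0 x1.
(* [x <= y ^+ k.+1] by Bernoulli, and [n%:R * y ^+ n] stays bounded, again by
   Bernoulli; the last factor [y ^+ n] tends to 0. *)
have k0 : 0 < k.+1%:R :> R by rewrite ltr0n.
have [c cE] : exists c, c = (1 - x) / k.+1%:R by exists ((1 - x) / k.+1%:R).
have c1 : c <= 1 - x.
  by rewrite cE ler_pdivrMr// ler_peMr ?ler1n// subr_ge0 ltW.
have c0 : 0 < c by rewrite cE divr_gt0// subr_gt0.
have [y yE] : exists y, y = 1 - c by exists (1 - c).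
have y0 : 0 < y by lra.
have y1 : y < 1 by lra.
have xy : x <= y ^+ k.+1.
  have : 1 + (- c) *+ k.+1 <= (1 - c) ^+ k.+1 by apply: bernoulli_le; lra.
  rewrite -yE -mulr_natr mulNr cE divfK ?gt_eqF//; lra.
pose h := y^-1 - 1.
have h0 : 0 < h by rewrite /h subr_gt0 invf_gt1.
have ny n : n%:R * y ^+ n <= h^-1.
  have : 1 + h *+ n <= (1 + h) ^+ n by apply: bernoulli_le; lra.
  rewrite (_ : 1 + h = y^-1) ?exprVn => [H|]; last by rewrite /h addrC subrK.
  have yn0 : 0 < y ^+ n by rewrite exprn_gt0.
  rewrite -(ler_pM2l h0) divff ?gt_eqF// mulrA -ler_pdivlMr// div1r mulr_natr.
  by apply: le_trans H; rewrite lerDr.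
have nx n : n%:R ^+ k * x ^+ n <= h^-1 ^+ k * y ^+ n.
  apply: (@le_trans _ _ (n%:R ^+ k * (y ^+ k.+1) ^+ n)).
    by rewrite ler_wpM2l ?exprn_ge0// lerXn2r ?nnegrE ?exprn_ge0// ltW.
  rewrite -exprM mulnC exprM exprSr mulrA -exprMn ler_pM2r ?exprn_gt0//.
  by rewrite lerXn2r ?nnegrE ?ny// ?invr_ge0 ?(ltW h0)// mulr_ge0// exprn_ge0// ltW.
apply: (@squeeze_cvgr _ _ _ _ (fun=> 0) (fun n => h^-1 ^+ k * y ^+ n)).
- by apply: nearW => n; rewrite nx andbT mulr_ge0// exprn_ge0// ltW.
- exact: cvg_cst.
- by apply: cvg_geometric; rewrite ger0_norm// ltW.
Qed.

(** Here [n.+1 ^ k] counts lists of points and [n.+1 - k] the candidates for extending one. The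
    factor [x ^- k] also absorbs the truncation of the subtraction, as [n.+1 <= k + (n.+1 - k)]
    always holds. *)
Lemma cvg_poly_geometric_shift x k : 0 < x -> x < 1 ->
  (x ^+ (n.+1 - k) *+ (n.+1 ^ k) : R) @[n --> \oo] --> (0 : R).
Proof.
move=> x0 x1.
apply: (@squeeze_cvgr _ _ _ _ (fun=> 0)
    (fun n => x ^- k * (n.+1%:R ^+ k * x ^+ n.+1))).
- apply: nearW => n; rewrite mulrn_wge0 ?exprn_ge0 ?(ltW x0)//=.
  rewrite -mulr_natr natrX [leLHS]mulrC [leRHS]mulrCA ler_wpM2l ?exprn_ge0//.
  rewrite ler_pdivlMl ?exprn_gt0// -exprD.
  by rewrite ler_wiXn2l ?(ltW x0) ?(ltW x1)//; lia.
- exact: cvg_cst.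
- rewrite -(mulr0 (x ^- k)); apply: cvgMr.
  have := @cvg_poly_geometric x k x0 x1; rewrite -(cvg_shiftS (fun n => n%:R ^+ k * x ^+ n)).
  exact.
Qed.

End polynomial_times_geometric.

(** * Random structures *)

Section random_structures.
Context {R : realType} {Rel : finType} {ar : Rel -> nat}.
Context (A : set R) (p : Rel -> probability R R).
Context (A_compact : compact A) (p_carrier : forall r, p r A = 1%E).
Context (p_full : forall r (U : set R), open U -> A `&` U !=set0 ->
    (0 < p r (A `&` U))%E).
Local Notation I := {r : Rel & (ar r).-tuple nat}.
Local Notation points n := (#|atom_index ar n.+1|.-tuple R).
Local Notation Pr n := (pr (rho ar p n.+1)).
Implicit Types (u : I -> R) (theta : R).

Lemma measurable_carrier : measurable A.
Proof. exact: compact_measurable. Qed.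

(* The coordinates deciding whether [b] extends [e] as prescribed by [u] mention
   [b]; hence they are disjoint for distinct [b] outside [e]. *)
Definition block n u theta (e : seq 'I_n.+1) (b : 'I_n.+1)
    (c : 'I_#|atom_index ar n.+1|) : set R :=
  let i : atom_index ar n.+1 := enum_val c in
  if (b \in tagged i) && all (mem (rcons e b)) (tagged i) then
    ball (u (existT _ (tag i) (map_tuple (index^~ (rcons e b)) (tagged i)))) theta
  else setT.

Lemma measurable_block n u theta (e : seq 'I_n.+1) b c :
  measurable (block u theta e b c).
Proof.
rewrite /block; case: ifP => _; last exact: measurableT.
by apply: open_measurable; exact: ball_open.
Qed.

Lemma block_indep n u theta (e : seq 'I_n.+1) b b' :
  b \notin e -> b != b' -> indep (block u theta e b) (block u theta e b').
Proof.
move=> be bb' c; rewrite /block.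
case: ifPn => [/andP[bc _]|_]; last by left.
case: ifPn => [/andP[_ /allP/(_ _ bc)]|_]; last by right.
by rewrite /= mem_rcons inE (negbTE be) (negbTE bb').
Qed.

(** A prescribed atom mentions position [size e], hence [b], so its coordinate is constrained by the
    block. Since [rcons e b] has no repetition, [index] recovers the positions from the points. *)
Lemma rect_block n u theta (e : seq 'I_n.+1) b (w : points n) :
  uniq e -> b \notin e -> rect (block u theta e b) w ->
  forall i, level (size e).+1 i -> ~~ level (size e) i ->
    `|diagram (interp_of w) (rcons e b) i - u i| < theta.
Proof.
move=> ue be wB [r ys] /allP /= ys_lt /allPn[y /= yys y_ge].
have ye : y = size e.
  by apply/eqP; rewrite eqn_leq -ltnS ys_lt//= leqNgt.
pose xs := map_tuple (nth ord0 (rcons e b)) ys.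
have := wB (enum_rank (existT _ r xs : atom_index ar n.+1)).
rewrite /block enum_rankK /=.
rewrite (_ : b \in _); last first.
  by apply/mapP; exists y => //; rewrite ye nth_rcons ltnn eqxx.
rewrite (_ : all _ _) /=; last first.
  apply/allP => _ /mapP[z zys ->] /=; apply: mem_nth.
  by rewrite size_rcons; exact: ys_lt.
rewrite (_ : map_tuple _ xs = ys); last first.
  apply: eq_from_tnth => j; rewrite !tnth_map index_uniq ?size_rcons//.
    by apply: ys_lt; exact: mem_tnth.
  by rewrite rcons_uniq be.
by rewrite /ball /= distrC.
Qed.

(** A bound independent of [n] and [e]: the product runs over all atoms over [k.+1] positions,
    including those without the new point, whose factors can only lower it. *)
Definition block_bound k u theta : R :=
  \prod_(i : atom_index ar k.+1)
    pr (p (tag i)) (ball (u (existT _ (tag i) (map_tuple val (tagged i)))) theta).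

Lemma block_bound_gt0 k u theta : valued A u -> 0 < theta ->
  0 < block_bound k u theta.
Proof.
move=> Au theta0; apply: prodr_gt0 => i _; set x := u _.
have Ox : open (ball x theta) by exact: ball_open.
have : (0 < p (tag i) (A `&` ball x theta))%E.
  by apply: p_full => //; exists x; split; [exact: Au|exact: ballxx].
rewrite prE ?lte_fin => [/lt_le_trans|]; last first.
  by apply: measurableI; [exact: measurable_carrier|exact: open_measurable].
apply; apply: le_pr => //.
  by apply: measurableI; [exact: measurable_carrier|exact: open_measurable].
exact: open_measurable.
Qed.

Lemma block_bound_le1 k u theta : block_bound k u theta <= 1.
Proof.
apply: prodr_ile1 => i _; rewrite pr_ge0 pr_le1//.
by apply: open_measurable; exact: ball_open.
Qed.

(** Replacing points by their positions in [rcons e b] maps the constrained coordinates injectively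
    to the factors of [block_bound]. Unconstrained coordinates contribute [1], and the surplus
    factors are at most [1]. *)
Lemma block_bound_le n k u theta (e : seq 'I_n.+1) b :
  uniq e -> size e = k -> b \notin e ->
  block_bound k u theta <= Pr n (rect (block u theta e b)).
Proof.
move=> ue ek be; rewrite /rho pr_rect; last exact: measurable_block.
pose F (j : atom_index ar k.+1) := pr (p (tag j))
  (ball (u (existT _ (tag j) (map_tuple val (tagged j)))) theta).
pose h (i : atom_index ar n.+1) : atom_index ar k.+1 :=
  existT _ (tag i) (map_tuple (fun x => inord (index x (rcons e b))) (tagged i)).
pose D := [set i : atom_index ar n.+1 |
  (b \in tagged i) && all (mem (rcons e b)) (tagged i)]%SET.
have idx x : x \in rcons e b -> (index x (rcons e b) < k.+1)%N.
  by rewrite -index_mem size_rcons ek.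
have h_inj : {in D &, injective h}.
  move=> [r xs] [r' xs']; rewrite !inE /= => /andP[_ /allP Dxs] /andP[_ /allP Dxs'].
  move=> hE; have rr' : r = r' := congr1 tag hE.
  move: xs' Dxs' hE; rewrite -{r'}rr' => xs' Dxs' /eqP.
  rewrite /h /= eq_Tagged /= => /eqP hE.
  congr existT; apply: eq_from_tnth => j.
  have := congr1 (fun t => val (tnth t j)) hE; rewrite !tnth_map.
  have jx := Dxs _ (mem_tnth j xs); have jx' := Dxs' _ (mem_tnth j xs').
  rewrite /= !inordK ?idx// => H.
  by rewrite -(nth_index ord0 jx) H nth_index.
rewrite -(big_enum_val (fun i : atom_index ar n.+1 =>
   pr (p (tag i)) (if (b \in tagged i) && all (mem (rcons e b)) (tagged i)
   then ball (u (existT _ (tag i) (map_tuple (index^~ (rcons e b)) (tagged i)))) theta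
   else setT))).
rewrite (bigID (mem D)) /= [X in _ <= _ * X]big1 ?mulr1; last first.
  by move=> i; rewrite inE => /negbTE ->; exact: prT.
rewrite (eq_bigr (F \o h)); last first.
  move=> i; rewrite inE => iD; rewrite iD /F /=.
  congr (pr _ (ball (u (existT _ _ _)) _)); apply: eq_from_tnth => j.
  rewrite !tnth_map inordK// idx//.
  by move: iD => /andP[_ /allP]; apply; exact: mem_tnth.
rewrite -(big_imset F h_inj) /block_bound [leLHS](bigID (mem [set h x | x in D]%SET)) /=.
rewrite ler_piMr//; first by apply: prodr_ge0 => i _; exact: pr_ge0.
apply: prodr_ile1 => i _; rewrite pr_ge0 pr_le1//.
by apply: open_measurable; exact: ball_open.
Qed.

(** Contains the event that the extension axiom fails, and is a finite combination of rectangles,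
    hence measurable. *)
Definition unextended n k u theta : set (points n) :=
  \big[setU/set0]_(e <- enum {: k.-tuple 'I_n.+1})
    (if uniq e then avoid (block u theta e) [seq b <- enum 'I_n.+1 | b \notin e]
     else set0).

Lemma measurable_unextended n k u theta :
  measurable (@unextended n k u theta).
Proof.
apply: bigsetU_measurable => e _; case: ifP => _; last exact: measurable0.
by apply: measurable_avoid => b i; exact: measurable_block.
Qed.

Lemma unextendedP n k u theta (w : points n) :
  ~ unextended k u theta w -> extension_axiom (interp_of w) k u theta.
Proof.
move=> nw e ue ek; move: nw; rewrite /unextended -bigcup_seq /= => nw.
have /avoidP[b] : ~ avoid (block u theta e) [seq b <- enum 'I_n.+1 | b \notin e] w.
  move=> we; apply: nw; exists (Tuple (introT eqP ek)) => /=.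
    by rewrite mem_enum.
  by rewrite ue.
rewrite mem_filter => /andP[be _] wB; exists b => //.
by rewrite -ek; exact: rect_block.
Qed.

(** Union bound over the lists [e], with independence of the candidates outside each list. Halving
    [block_bound] keeps the base of the power positive even when [block_bound] is [1]. *)
Lemma pr_unextended_le n k u theta : valued A u -> 0 < theta ->
  Pr n (unextended k u theta) <=
    (1 - block_bound k u theta / 2) ^+ (n.+1 - k) *+ (n.+1 ^ k).
Proof.
move=> Au theta0; set q := block_bound k u theta.
have q0 : 0 < q by exact: block_bound_gt0.
have q1 : q <= 1 by exact: block_bound_le1.
have -> : (n.+1 ^ k)%N = size (enum {: k.-tuple 'I_n.+1}).
  by rewrite -cardE card_tuple card_ord.
apply: pr_bigU_le => e.
  case: ifP => _; last exact: measurable0.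
  by apply: measurable_avoid => b i; exact: measurable_block.
have x0 : 0 <= 1 - q / 2 by lra.
case: ifPn => ue; last by rewrite /pr measure0 exprn_ge0.
apply: (@le_trans _ _ ((1 - q) ^+ (n.+1 - k))); last first.
  by rewrite lerXn2r ?nnegrE//; lra.
have -> : (n.+1 - k)%N = size [seq b <- enum 'I_n.+1 | b \notin e].
  have ke : count (mem e) (enum 'I_n.+1) = k.
    rewrite -size_filter -[RHS](size_tuple e); apply: perm_size.
    apply: uniq_perm => //; first by rewrite filter_uniq// enum_uniq.
    by move=> x; rewrite mem_filter mem_enum /= andbT.
  have := count_predC (mem e) (enum 'I_n.+1).
  by rewrite size_enum_ord ke size_filter => H; rewrite -[X in (X - k)%N]H addKn.
apply: pr_avoid_le.
- by move=> b i; exact: measurable_block.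
- move=> b b'; rewrite !mem_filter => /andP[be _] _; exact: block_indep.
- by rewrite filter_uniq// enum_uniq.
- move=> b; rewrite mem_filter => /andP[be _].
  by apply: block_bound_le => //; rewrite size_tuple.
Qed.

Lemma cvg_pr_unextended k u theta : valued A u -> 0 < theta ->
  Pr n (unextended k u theta) @[n --> \oo] --> (0 : R).
Proof.
move=> Au theta0; set q := block_bound k u theta.
have q0 : 0 < q by exact: block_bound_gt0.
have q1 : q <= 1 by exact: block_bound_le1.
apply: (@squeeze_cvgr _ _ _ _ (fun=> 0)
    (fun n => (1 - q / 2) ^+ (n.+1 - k) *+ (n.+1 ^ k))).
- by apply: nearW => n; rewrite pr_ge0 pr_unextended_le.
- exact: cvg_cst.
- by apply: cvg_poly_geometric_shift; lra.
Qed.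

(** Only finitely many extension axioms are involved; [E] is the union of the corresponding events
    [unextended]. *)
Lemma asym_unlikely (Q : forall n, interpretation R ar 'I_n.+1 -> Prop) :
  asym A Q -> exists E : forall n, set (points n),
  [/\ (forall n, measurable (E n)),
      (forall n (w : points n), interp_valued A (interp_of w) -> ~ E n w ->
        Q n (interp_of w)) &
      Pr n (E n) @[n --> \oo] --> (0 : R)].
Proof.
move=> [L AL LQ].
suff [E [mE EL cE]] : exists E : forall n, set (points n),
    [/\ (forall n, measurable (E n)),
        (forall n (w : points n), ~ E n w -> forall x, List.In x L ->
          extension_axiom (interp_of w) x.1.1 x.1.2 x.2) &
        Pr n (E n) @[n --> \oo] --> (0 : R)].
  exists E; split=> // n w Aw nE; apply: LQ => // x; exact: EL.
elim: L AL {LQ} => [|[[k u] theta] L IH] AL.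
  exists (fun n => set0); split=> [n|n w _ x []|]; first exact: measurable0.
  have -> : (fun n => Pr n set0) = fun=> 0.
    by apply/funext => n; rewrite /pr measure0.
  exact: cvg_cst.
have [/= Au theta0] : valued A (k, u, theta).1.2 /\ 0 < (k, u, theta).2.
  by apply: AL; left.
have [x xL|E [mE EL cE]] := IH; first by apply: AL; right.
exists (fun n => unextended k u theta `|` E n); split.
- by move=> n; apply: measurableU; [exact: measurable_unextended|exact: mE].
- move=> n w nw x [<-|xL] /=.
    by apply: unextendedP => h; apply: nw; left.
  by apply: EL xL => h; apply: nw; right.
- apply: (@squeeze_cvgr _ _ _ _ (fun=> 0)
      (fun n => Pr n (unextended k u theta) + Pr n (E n))).
  + apply: nearW => n; rewrite pr_ge0 prU_le//; first exact: measurable_unextended.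
    exact: mE.
  + exact: cvg_cst.
  + rewrite -(addr0 0); apply: cvgD => //.
    exact: cvg_pr_unextended.
Qed.

Definition carried n : set (points n) := rect (fun=> A).

Lemma measurable_carried n : measurable (@carried n).
Proof. by apply: measurable_rect => i; exact: measurable_carrier. Qed.

Lemma pr_carried n : Pr n (@carried n) = 1.
Proof.
rewrite /carried /rho pr_rect; last by move=> i; exact: measurable_carrier.
by rewrite big1// => i _; rewrite /pr p_carrier.
Qed.

Lemma carried_valued n (w : points n) :
  carried w -> interp_valued A (interp_of w).
Proof. by move=> Aw r xs; exact: Aw. Qed.

Lemma measurable_sup_ord n d (T : measurableType d) (h : 'I_n.+1 -> T -> R) :
  (forall a, measurable_fun setT (h a)) ->
  measurable_fun setT (fun t => sup (range (h ^~ t))).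
Proof.
move=> mh.
have -> : (fun t => sup (range (h ^~ t))) =
    (fun t => \big[Num.max/h ord0 t]_(a < n.+1) h a t).
  apply/funext => t; have [a [-> amax]] := sup_range_ord (h ^~ t).
  apply/eqP; rewrite eq_le (bigmax_sup a)//=.
  by apply: bigmax_le => [|b _]; exact: amax.
elim: (index_enum _) => [|a s IH].
  by under eq_fun do rewrite big_nil; exact: mh.
by under eq_fun do rewrite big_cons; apply: measurable_maxr; [exact: mh|].
Qed.

Lemma measurable_inf_ord n d (T : measurableType d) (h : 'I_n.+1 -> T -> R) :
  (forall a, measurable_fun setT (h a)) ->
  measurable_fun setT (fun t => inf (range (h ^~ t))).
Proof.
move=> mh; under eq_fun do rewrite inf_range_opp.
apply: measurableT_comp => //.
by apply: (measurable_sup_ord (h := fun a t => - h a t)) => a; exact: measurableT_comp.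
Qed.

(** * Measurability of truth values and almost sure values *)

Section value_measurability.
Context (neg : R -> R) (A_neg : forall x, A x -> A (neg x)).
Context (neg_continuous : {within A, continuous neg}).

Lemma measurable_value (neg' : R -> R) n (v : nat -> 'I_n.+1) (phi : formula ar) :
  measurable_fun setT neg' ->
  measurable_fun setT (fun w : points n => value neg' (interp_of w) v phi).
Proof.
move=> mneg; elim: phi v => [r xs|f IHf g IHg|f IHf g IHg|f IHf|x f IHf|x f IHf] v /=.
- exact: measurable_tnth.
- exact: measurable_minr.
- exact: measurable_maxr.
- exact: measurableT_comp.
- apply: measurable_inf_ord => a; exact: IHf.
- apply: measurable_sup_ord => a; exact: IHf.
Qed.

(** Nothing is known of [neg] outside [A]. Its restriction, constant there, is measurable, so events
    about values can be measured through it. *)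
Lemma value_restrict n (M : interpretation R ar 'I_n.+1) v phi :
  interp_valued A M ->
  value (neg \_ A) M v phi = value neg M v phi.
Proof.
move=> AM; elim: phi v => [r xs|f IHf g IHg|f IHf g IHg|f IHf|x f IHf|x f IHf] v //=.
- by rewrite IHf IHg.
- by rewrite IHf IHg.
- by rewrite IHf patchE mem_set//; exact: value_in.
- by under eq_fun do rewrite IHf.
- by under eq_fun do rewrite IHf.
Qed.

Lemma measurable_value_event n (phi : formula ar) (V : set R) : open V ->
  measurable [set w : points n | (forall i, A (tnth w i)) /\
    V (value neg (interp_of w) (fun=> ord0) phi)].
Proof.
move=> oV.
rewrite (_ : [set _ | _] = @carried n `&`
    ((fun w => value (neg \_ A) (interp_of w) (fun=> ord0) phi) @^-1` V)).
  apply: measurableI; first exact: measurable_carried.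
  rewrite -[X in measurable X]setTI; apply: measurable_value => //.
    apply: (iffLR (measurable_restrictT _ measurable_carrier)).
    exact: subspace_continuous_measurable_fun measurable_carrier neg_continuous.
  exact: open_measurable.
apply/seteqP; split=> w /= [Aw Vw]; split=> //; move: Vw;
  by rewrite /= value_restrict//; exact: carried_valued.
Qed.

(** Outside the exceptional event [E], an [A]-valued structure gives [phi] a value in a ball around
    [c] inside [V], and the probability of [E] tends to [0]. *)
Lemma asym_almost_surely (phi : formula ar) (c : R) :
  (forall eta, 0 < eta -> asym A (fun n M =>
    `|value neg M (fun=> ord0) phi - c| <= eta)) ->
  almost_surely A neg p phi c.
Proof.
move=> H V oV Vc.
have [eta /= eta0 etaV] : exists2 e, 0 < e & ball c e `<=` V.
  by move/nbhs_ballP: (open_nbhs_nbhs (conj oV Vc)) => [e e0 eV]; exists e.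
have eta20 : 0 < eta / 2 by rewrite divr_gt0.
have [E [mE EV cE]] := asym_unlikely (H _ eta20).
pose X n := [set w : points n | (forall i, A (tnth w i)) /\
    V (value neg (interp_of w) (fun=> ord0) phi)].
have mX n : measurable (X n) by exact: measurable_value_event.
have sub n : @carried n `\` E n `<=` X n.
  move=> w [Aw nE]; split=> //; apply: etaV; rewrite /ball /= distrC.
  have := EV n w (carried_valued Aw) nE => /le_lt_trans; apply.
  by rewrite ltr_pdivrMr// ltr_pMr// ltr1n.
have lb n : 1 - Pr n (E n) <= Pr n (X n).
  apply: (@le_trans _ _ (Pr n (@carried n `\` E n))).
    rewrite prD; [|exact: measurable_carried|exact: mE].
    rewrite pr_carried lerB//; apply: le_pr; [|exact: mE|exact: subIsetr].
    by apply: measurableI; [exact: measurable_carried|exact: mE].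
  apply: le_pr; [|exact: mX|exact: sub].
  by apply: measurableD; [exact: measurable_carried|exact: mE].
apply: cvg_EFin; first by apply: nearW => n; apply: fin_num_measure; exact: mX.
apply: (@squeeze_cvgr _ _ _ _ (fun n => 1 - Pr n (E n)) (fun=> 1)).
- by apply: nearW => n; apply/andP; split; [exact: lb|apply: pr_le1; exact: mX].
- by rewrite -[X in _ --> X](subr0 1); apply: cvgB => //; exact: cvg_cst.
- exact: cvg_cst.
Qed.

(** Balls around two distinct limits, of radius half their distance, are disjoint, yet each would
    eventually have probability above one half. *)
Lemma almost_surely_unique (phi : formula ar) (c c' : R) :
  almost_surely A neg p phi c -> almost_surely A neg p phi c' -> c = c'.
Proof.
move=> Hc Hc'; apply/eqP/negPn/negP => cc'.
pose eta := `|c - c'| / 2.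
have eta0 : 0 < eta by rewrite divr_gt0// normr_gt0 subr_eq0.
pose X z n := [set w : points n | (forall i, A (tnth w i)) /\
    ball z eta (value neg (interp_of w) (fun=> ord0) phi)].
have mX z n : measurable (X z n) by apply: measurable_value_event; exact: ball_open.
have Hb z : almost_surely A neg p phi z -> \forall n \near \oo, 2^-1 < Pr n (X z n).
  move=> Hz; have /fine_cvg := Hz _ (ball_open z eta) (ballxx z eta0).
  by move=> /cvgr_gt; apply; rewrite invf_lt1// ltr1n.
near \oo => n.
have h : 2^-1 < Pr n (X c n) by near: n; exact: Hb.
have h' : 2^-1 < Pr n (X c' n) by near: n; exact: Hb.
have : Pr n (X c' n) <= Pr n (~` X c n).
  apply: le_pr; [exact: mX|by apply: measurableC; exact: mX|].
  move=> w [_ wc'] [_ wc]; have : `|c - c'| < eta + eta.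
    rewrite (le_lt_trans (ler_distD (value neg (interp_of w) (fun=> ord0) phi) _ _))//.
    by rewrite ltrD// distrC.
  by rewrite /eta -splitr ltxx.
rewrite prC; [lra|exact: mX].
Unshelve. all: by end_near.
Qed.

End value_measurability.

End random_structures.

(** * The six constants *)

(** The constant [c] is split off. The real [z] stands for a common lower bound of [top] and of the
    literals at [x], so the last condition bounds their minimum by [kappa], also when [js] is
    empty. *)
Lemma attained_criterion {R : realType} (A K : set R) (G : nat -> R -> R) top :
  (forall c, K c -> c <= top) ->
  (forall js : seq nat, exists u kappa, [/\ A u, K kappa,
    {in js, forall j, kappa <= G j u} &
    forall x z, A x -> z <= top -> {in js, forall j, z <= G j x} -> z <= kappa]) ->
  attained A K G.
Proof.
move=> Ktop H c js Kc; have [u [kappa [Au Kk ku kmax]]] := H js.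
have mE : foldr (fun j => Num.min (G j u)) c js = Num.min c kappa.
  apply/eqP; rewrite eq_le; apply/andP; split.
    have := lexx (foldr (fun j => Num.min (G j u)) c js).
    rewrite le_foldr_min => /andP[mc /allP mj]; rewrite le_min mc /=.
    by apply: (kmax u) => //; exact: le_trans mc (Ktop _ Kc).
  rewrite le_foldr_min ge_min lexx /=; apply/allP => j /ku kj.
  by rewrite ge_min kj orbT.
exists u; rewrite mE; split=> //; first by case: leP.
move=> x Ax; have := lexx (foldr (fun j => Num.min (G j x)) c js).
rewrite le_foldr_min => /andP[mc /allP mj]; rewrite le_min mc /=.
by apply: (kmax x) => //; exact: le_trans mc (Ktop _ Kc).
Qed.

(** * Negation on [A] and the listed constants *)

Section negation.
Context {R : realType} (A : set R) (neg : R -> R).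
Context (A01 : A `<=` `[0, 1]) (A_compact : compact A) (A0 : A 0) (A1 : A 1).
Context (A_neg : forall v, A v -> A (neg v)).
Context (neg_continuous : {within A, continuous neg}).
Context (neg_min : forall v w, A v -> A w ->
    neg (Num.min v w) = Num.max (neg v) (neg w)).
Context (neg_max : forall v w, A v -> A w ->
    neg (Num.max v w) = Num.min (neg v) (neg w)).
Context (neg_neg : forall v, A v -> v <= neg (neg v)) (neg1 : neg 1 = 0).

Lemma carrier_ge0 x : A x -> 0 <= x.
Proof. by move=> /A01; rewrite /= in_itv /= => /andP[]. Qed.

Lemma carrier_le1 x : A x -> x <= 1.
Proof. by move=> /A01; rewrite /= in_itv /= => /andP[]. Qed.

Lemma neg_anti x y : A x -> A y -> x <= y -> neg y <= neg x.
Proof.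
by move=> Ax Ay /min_idPl xy; rewrite -xy neg_min// le_max lexx orbT.
Qed.

Lemma neg0 : neg 0 = 1.
Proof.
apply/eqP; rewrite eq_le carrier_le1 /=; last exact: A_neg.
by rewrite -neg1 neg_neg.
Qed.

(** One inequality is [neg_neg] at [neg x], the other is [neg_neg] at [x] reversed by [neg]. *)
Lemma neg3 x : A x -> neg (neg (neg x)) = neg x.
Proof.
move=> Ax; have An := A_neg Ax; have Ann := A_neg An.
apply/eqP; rewrite eq_le neg_anti ?neg_neg//.
Qed.

Lemma iter_negE j x : A x -> iter j neg x =
  if odd j then neg x else if j == 0%N then x else neg (neg x).
Proof.
move=> Ax; elim: j => [//|[//|j] IH]; rewrite iterS IH /= negbK.
by case: (odd j) => //=; rewrite neg3.
Qed.

Lemma neg_unif_on : unif_on A neg.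
Proof. exact: within_continuous_unif_on. Qed.

Lemma unif_on_id : unif_on A id.
Proof. by move=> eta eta0; exists eta. Qed.

Lemma neg2_unif_on : unif_on A (fun x => neg (neg x)).
Proof. by apply: unif_on_comp; [exact: A_neg|exact: neg_unif_on..]. Qed.

Lemma sup_image_attained (f : R -> R) : unif_on A f ->
  exists u, [/\ A u, sup [set f x | x in A] = f u & forall x, A x -> f x <= f u].
Proof.
move=> /unif_on_within_continuous cf.
have [|u uA umax] := compact_EVT_max _ A_compact cf; first by exists 0.
exists u; rewrite inE in uA; split=> // [|x Ax]; last by apply: umax; rewrite inE.
apply/eqP; rewrite eq_le; apply/andP; split.
  by apply: ge_sup => [|_ [x Ax <-]]; [exists (f u), u|apply: umax; rewrite inE].
apply: ub_le_sup; last by exists u.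
by exists (f u) => _ [x Ax <-]; apply: umax; rewrite inE.
Qed.

Lemma inf_image_attained (f : R -> R) : unif_on A f ->
  exists u, [/\ A u, inf [set f x | x in A] = f u & forall x, A x -> f u <= f x].
Proof.
move=> uf; have [|u [Au uE umin]] := @sup_image_attained (fun x => - f x).
  move=> eta /uf[theta theta0 H]; exists theta => // x y Ax Ay xy.
  by rewrite -opprD normrN; exact: H.
exists u; split=> // [|x Ax]; last by rewrite -lerN2 umin.
by rewrite /inf image_comp uE opprK.
Qed.

Let epsilon := sup [set Num.min x (neg x) | x in A].
Let epsilon' := sup [set Num.min (neg x) (neg (neg x)) | x in A].
Let delta := inf [set Num.max x (neg x) | x in A].
Let delta' := inf [set Num.max (neg x) (neg (neg x)) | x in A].

Definition listed : set R := [set a | [\/ a = 0, a = 1 | a = epsilon] \/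
                                      [\/ a = epsilon', a = delta | a = delta']].

Let eps_att := sup_image_attained (unif_on_min unif_on_id neg_unif_on).
Let eps'_att := sup_image_attained (unif_on_min neg_unif_on neg2_unif_on).
Let delta_att := inf_image_attained (unif_on_max unif_on_id neg_unif_on).
Let delta'_att := inf_image_attained (unif_on_max neg_unif_on neg2_unif_on).

Lemma listed_sub : listed `<=` A.
Proof.
have minA x y : A x -> A y -> A (Num.min x y) by case: leP.
have maxA x y : A x -> A y -> A (Num.max x y) by case: leP.
move=> a [[->//|->//|->]|[->|->|->]].
- have [u [Au uE _]] := eps_att.
  by rewrite [epsilon]uE; apply: minA => //; exact: A_neg.
- have [u [Au uE _]] := eps'_att.
  by rewrite [epsilon']uE; apply: minA; do ?exact: A_neg; exact/A_neg/A_neg.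
- have [u [Au uE _]] := delta_att.
  by rewrite [delta]uE; apply: maxA => //; exact: A_neg.
- have [u [Au uE _]] := delta'_att.
  by rewrite [delta']uE; apply: maxA; do ?exact: A_neg; exact/A_neg/A_neg.
Qed.

Lemma listed0 : listed 0. Proof. by left; constructor 1. Qed.
Lemma listed1 : listed 1. Proof. by left; constructor 2. Qed.
Lemma listed_epsilon : listed epsilon. Proof. by left; constructor 3. Qed.
Lemma listed_epsilon' : listed epsilon'. Proof. by right; constructor 1. Qed.
Lemma listed_delta : listed delta. Proof. by right; constructor 2. Qed.
Lemma listed_delta' : listed delta'. Proof. by right; constructor 3. Qed.

(** The antitone map [neg] turns a maximum into a minimum, and by De Morgan it sends
    [Num.min x (neg x)] to the expression under [delta']. *)
Lemma neg_epsilon : neg epsilon = delta'.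
Proof.
have [u [Au uE umax]] := eps_att; have [v [Av vE vmin]] := delta'_att.
apply/eqP; rewrite eq_le [delta']vE [epsilon]uE; apply/andP; split; last first.
  by rewrite neg_min//; [exact: (vmin u Au)|exact: A_neg].
rewrite -neg_min//; last exact: A_neg.
by apply: neg_anti; [case: leP => _ //; exact: A_neg..|exact: (umax v Av)].
Qed.

(** By [neg3], [neg] exchanges [neg x] and [neg (neg x)]; hence [epsilon'] has the same negation as
    [epsilon]. *)
Lemma neg_epsilon' : neg epsilon' = delta'.
Proof.
have [u [Au uE umax]] := eps'_att; have [v [Av vE vmin]] := delta'_att.
have [Anu Anv] := (A_neg Au, A_neg Av).
have [Annu Annv] := (A_neg Anu, A_neg Anv).
apply/eqP; rewrite eq_le [delta']vE [epsilon']uE; apply/andP; split; last first.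
  by rewrite neg_min// neg3// [leRHS]maxC; exact: (vmin u Au).
rewrite maxC -{2}(neg3 Av) -neg_min//.
by apply: neg_anti; [case: leP..|exact: (umax v Av)].
Qed.

Lemma neg_delta : neg delta = epsilon'.
Proof.
have [u [Au uE umin]] := delta_att; have [v [Av vE vmax]] := eps'_att.
apply/eqP; rewrite eq_le [epsilon']vE [delta]uE; apply/andP; split.
  by rewrite neg_max//; [exact: (vmax u Au)|exact: A_neg].
rewrite -neg_max//; last exact: A_neg.
by apply: neg_anti; [case: leP => _ //; exact: A_neg..|exact: (umin v Av)].
Qed.

Lemma neg_delta' : neg delta' = epsilon'.
Proof.
have [u [Au uE umin]] := delta'_att; have [v [Av vE vmax]] := eps'_att.
have [Anu Anv] := (A_neg Au, A_neg Av).
have [Annu Annv] := (A_neg Anu, A_neg Anv).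
apply/eqP; rewrite eq_le [epsilon']vE [delta']uE; apply/andP; split.
  by rewrite neg_max// neg3// [leLHS]minC; exact: (vmax u Au).
rewrite minC -{2}(neg3 Av) -neg_max//.
by apply: neg_anti; [case: leP..|exact: (umin v Av)].
Qed.

Lemma listed_neg a : listed a -> listed (neg a).
Proof.
move=> [[->|->|->]|[->|->|->]].
- by rewrite neg0; exact: listed1.
- by rewrite neg1; exact: listed0.
- by rewrite neg_epsilon; exact: listed_delta'.
- by rewrite neg_epsilon'; exact: listed_delta'.
- by rewrite neg_delta; exact: listed_epsilon'.
- by rewrite neg_delta'; exact: listed_epsilon'.
Qed.

(** Cases according to the iterates that occur. Even ones alone are all [1] at [x = 1], odd ones
    alone at [x = 0]. In a mixed list [neg (neg x)] is redundant beside [x], which leaves [epsilon]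
    if [x] occurs and [epsilon'] otherwise. *)
Lemma listed_attained_sup : attained A listed (fun j => iter j neg).
Proof.
apply: (@attained_criterion _ _ _ _ 1) => [c /listed_sub|js].
  exact: carrier_le1.
have iterE x : A x -> {in js, forall j, iter j neg x =
    if odd j then neg x else if j == 0%N then x else neg (neg x)}.
  by move=> Ax j _; exact: iter_negE.
have [/hasP[i ijs oi]|/hasPn noodd] := boolP (has odd js); last first.
  exists 1, 1; split=> // [|j jjs]; first exact: listed1.
  by rewrite iterE// (negbTE (noodd _ jjs)) neg1 neg0; case: ifP.
have [z0|nz0] := boolP (0%N \in js).
  have [u [Au uE umax]] := eps_att.
  exists u, epsilon; split=> // [|j jjs|x z Ax _ zx]; first exact: listed_epsilon.
    have := lexx epsilon; rewrite {2}[epsilon]uE le_min => /andP[eu enu].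
    rewrite iterE//; case: ifP => // _; case: ifP => // _.
    exact: le_trans eu (neg_neg Au).
  rewrite [epsilon]uE; apply: le_trans (umax _ Ax); rewrite le_min.
  by have := zx _ z0; have := zx _ ijs; rewrite !iterE// oi => -> ->.
have [/hasP[k kjs ek]|/hasPn nee] := boolP (has (predC odd) js).
  have [u [Au uE umax]] := eps'_att.
  exists u, epsilon'; split=> // [|j jjs|x z Ax _ zx]; first exact: listed_epsilon'.
    have := lexx epsilon'; rewrite {2}[epsilon']uE le_min => /andP[eu enu].
    by rewrite iterE//; case: ifP => // _; case: eqP => // j0; rewrite -j0 jjs in nz0.
  rewrite [epsilon']uE; apply: le_trans (umax _ Ax); rewrite le_min.
  have := zx _ kjs; have := zx _ ijs; rewrite !iterE// oi (negbTE ek) => ->.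
  by case: eqP => // k0; rewrite -k0 kjs in nz0.
exists 0, 1; split=> // [|j jjs]; first exact: listed1.
by have := nee _ jjs; rewrite /= negbK iterE// => ->; rewrite neg0.
Qed.

(** Dual cases, except that in a maximum it is [x] that is redundant beside [neg (neg x)]: a mixed
    list gives [delta'] if a positive even iterate occurs and [delta] otherwise. *)
Lemma listed_attained_inf :
  attained A [set - x | x in listed] (fun j x => - iter j neg x).
Proof.
apply: (@attained_criterion _ _ _ _ 0) => [_ [c /listed_sub Ac <-]|js].
  by rewrite oppr_le0; exact: carrier_ge0.
have N0 : [set - x | x in listed] 0 by exists 0; [exact: listed0|rewrite oppr0].
have iterE x : A x -> {in js, forall j, iter j neg x =
    if odd j then neg x else if j == 0%N then x else neg (neg x)}.
  by move=> Ax j _; exact: iter_negE.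
have [/hasP[i ijs oi]|/hasPn noodd] := boolP (has odd js); last first.
  exists 0, 0; split=> // j jjs.
  rewrite iterE// (negbTE (noodd _ jjs)) neg0 neg1.
  by case: ifP; rewrite oppr0.
have [/hasP[k kjs /= /andP[ek k0]]|/hasPn nee] :=
    boolP (has (fun j => ~~ odd j && (j != 0%N)) js).
  have [u [Au uE umin]] := delta'_att.
  exists u, (- delta'); split=> // [|j jjs|x z Ax _ zx].
  - by exists delta' => //; exact: listed_delta'.
  - have := lexx delta'; rewrite {1}[delta']uE ge_max => /andP[nud nnud].
    rewrite lerN2 iterE//; case: ifP => // _; case: ifP => // _.
    exact: le_trans (neg_neg Au) nnud.
  - rewrite lerNr; rewrite [delta']uE; apply: le_trans (umin _ Ax) _.
    rewrite ge_max ![_ <= - z]lerNr; have := zx _ kjs; have := zx _ ijs.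
    by rewrite !iterE// oi (negbTE ek) (negbTE k0) => -> ->.
have [z0|nz0] := boolP (0%N \in js).
  have [u [Au uE umin]] := delta_att.
  exists u, (- delta); split=> // [|j jjs|x z Ax _ zx].
  - by exists delta => //; exact: listed_delta.
  - have := lexx delta; rewrite {1}[delta]uE ge_max => /andP[ud nud].
    rewrite lerN2 iterE//; case: ifP => // oj; case: eqP => // j0.
    by have := nee _ jjs; rewrite oj /=; case: eqP.
  - rewrite lerNr; rewrite [delta]uE; apply: le_trans (umin _ Ax) _.
    rewrite ge_max ![_ <= - z]lerNr; have := zx _ z0; have := zx _ ijs.
    by rewrite !iterE// oi => -> ->.
exists 1, 0; split=> // j jjs; rewrite iterE// neg1 neg0.
have := nee _ jjs; rewrite negb_and !negbK => /orP[->|/eqP j0].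
  by rewrite oppr0.
by rewrite -j0 jjs in nz0.
Qed.

(** * Sentences for the listed constants *)

Section witnesses.
Context {Rel : finType} {ar : Rel -> nat} (r : Rel) (ar_gt0 : (0 < ar r)%N).

Definition diag n (M : interpretation R ar 'I_n.+1) (b : 'I_n.+1) : R :=
  M r (nseq_tuple (ar r) b).

(** Extension axiom for [k = 0]: the atom of [r] with all arguments at position [0] has level [1],
    and not level [0] because the arity is positive. *)
Lemma asym_diag u theta : A u -> 0 < theta ->
  asym A (fun n (M : interpretation R ar 'I_n.+1) =>
    exists b, `|diag M b - u| < theta).
Proof.
move=> Au theta0; have := @asym_extension _ _ ar A 0 (fun=> u) theta (fun=> Au) theta0.
apply: asymW => n M AM /(_ [::] isT erefl)[b _ Hb]; exists b.
have := Hb (existT _ r (nseq_tuple (ar r) 0%N)).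
rewrite /level /diagram /= !all_nseq /= orbT orbF -lt0n => /(_ isT ar_gt0).
congr (`|M r _ - _| < _); apply: eq_from_tnth => j.
by rewrite tnth_map !(tnth_nth 0%N) !(tnth_nth ord0) /= !nth_nseq ltn_ord.
Qed.

Definition diagonal_formula (phi : formula ar) (g : R -> R) :=
  all (pred1 0%N) (free_vars phi) /\
  forall n (M : interpretation R ar 'I_n.+1) v,
    value neg M v phi = g (diag M (v 0%N)).

(** No point exceeds [g u], and some point has its diagonal atom so close to [u] that [g] nearly
    reaches this bound. *)
Lemma asym_exists phi g u : diagonal_formula phi g -> unif_on A g -> A u ->
  (forall x, A x -> g x <= g u) -> forall eta, 0 < eta ->
  asym A (fun n (M : interpretation R ar 'I_n.+1) =>
    `|value neg M (fun=> ord0) (Exists 0 phi) - g u| <= eta).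
Proof.
move=> [_ phiE] ug Au umax eta /ug[theta theta0 H].
apply: asymW (asym_diag Au theta0) => n M AM [b bu] /=.
have [a [-> amax]] := sup_range_ord
  (fun a => value neg M (update (fun=> ord0) 0%N a) phi).
have := amax b; rewrite !phiE /update eqxx => ba.
have := H _ _ (AM _ _) Au bu; rewrite -/(diag M b) ltr_distl => /andP[h _].
have := umax _ (AM r (nseq_tuple (ar r) a)); rewrite -/(diag M a) => au.
by rewrite ler_distl; apply/andP; split; lra.
Qed.

Lemma asym_forall phi g u : diagonal_formula phi g -> unif_on A g -> A u ->
  (forall x, A x -> g u <= g x) -> forall eta, 0 < eta ->
  asym A (fun n (M : interpretation R ar 'I_n.+1) =>
    `|value neg M (fun=> ord0) (Forall 0 phi) - g u| <= eta).
Proof.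
move=> [_ phiE] ug Au umin eta /ug[theta theta0 H].
apply: asymW (asym_diag Au theta0) => n M AM [b bu] /=.
rewrite inf_range_opp; have [a [-> amax]] := sup_range_ord
  (fun a => - value neg M (update (fun=> ord0) 0%N a) phi).
have := amax b; rewrite !phiE /update eqxx => ba.
have := H _ _ (AM _ _) Au bu; rewrite -/(diag M b) ltr_distl => /andP[_ h].
have := umin _ (AM r (nseq_tuple (ar r) a)); rewrite -/(diag M a) => au.
by rewrite ler_distl; apply/andP; split; lra.
Qed.

Lemma sentence_quantified phi g : diagonal_formula phi g ->
  sentence (Exists 0 phi) /\ sentence (Forall 0 phi).
Proof.
move=> [/allP f0 _]; rewrite /sentence /=.
suff -> : [seq y <- free_vars phi | y != 0%N] = [::] by [].
apply/eqP; rewrite -[_ == _]negbK -has_filter; apply/hasPn => y /f0 /= ->.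
by [].
Qed.

(** Each constant is an extremum over [A] of a one-variable term, [x] itself for [0] and [1];
    quantifying that term over the diagonal atom gives the sentence. *)
Lemma listed_asym a : listed a -> exists2 phi : formula ar, sentence phi &
  forall eta, 0 < eta -> asym A (fun n (M : interpretation R ar 'I_n.+1) =>
    `|value neg M (fun=> ord0) phi - a| <= eta).
Proof.
pose psi : formula ar := Atom (nseq_tuple (ar r) 0%N).
have psi_d : diagonal_formula psi id.
  split=> [|n M v /=]; first by rewrite /= all_nseq orbT.
  rewrite /diag; congr (M r _); apply: eq_from_tnth => j.
  by rewrite tnth_map !(tnth_nth 0%N) !(tnth_nth ord0) /= !nth_nseq ltn_ord.
have neg_d phi g : diagonal_formula phi g ->
    diagonal_formula (Neg phi) (fun x => neg (g x)).
  by move=> [fv E]; split=> // n M v /=; rewrite E.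
have and_d phi g phi' g' : diagonal_formula phi g -> diagonal_formula phi' g' ->
    diagonal_formula (And phi phi') (fun x => Num.min (g x) (g' x)).
  move=> [fv E] [fv' E']; split=> [|n M v /=]; last by rewrite E E'.
  by rewrite /= all_cat fv.
have or_d phi g phi' g' : diagonal_formula phi g -> diagonal_formula phi' g' ->
    diagonal_formula (Or phi phi') (fun x => Num.max (g x) (g' x)).
  move=> [fv E] [fv' E']; split=> [|n M v /=]; last by rewrite E E'.
  by rewrite /= all_cat fv.
have npsi_d := neg_d _ _ psi_d; have nnpsi_d := neg_d _ _ npsi_d.
move=> [[->|->|->]|[->|->|->]].
- exists (Forall 0 psi); first by have [] := sentence_quantified psi_d.
  by apply: (asym_forall psi_d unif_on_id A0) => x; exact: carrier_ge0.
- exists (Exists 0 psi); first by have [] := sentence_quantified psi_d.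
  by apply: (asym_exists psi_d unif_on_id A1) => x; exact: carrier_le1.
- have D := and_d _ _ _ _ psi_d npsi_d; have [u [Au uE umax]] := eps_att.
  exists (Exists 0 (And psi (Neg psi))); first by have [] := sentence_quantified D.
  rewrite [epsilon]uE; apply: (asym_exists D _ Au umax).
  exact: unif_on_min unif_on_id neg_unif_on.
- have D := and_d _ _ _ _ npsi_d nnpsi_d; have [u [Au uE umax]] := eps'_att.
  exists (Exists 0 (And (Neg psi) (Neg (Neg psi)))).
    by have [] := sentence_quantified D.
  rewrite [epsilon']uE; apply: (asym_exists D _ Au umax).
  exact: unif_on_min neg_unif_on neg2_unif_on.
- have D := or_d _ _ _ _ psi_d npsi_d; have [u [Au uE umin]] := delta_att.
  exists (Forall 0 (Or psi (Neg psi))); first by have [] := sentence_quantified D.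
  rewrite [delta]uE; apply: (asym_forall D _ Au umin).
  exact: unif_on_max unif_on_id neg_unif_on.
- have D := or_d _ _ _ _ npsi_d nnpsi_d; have [u [Au uE umin]] := delta'_att.
  exists (Forall 0 (Or (Neg psi) (Neg (Neg psi)))).
    by have [] := sentence_quantified D.
  rewrite [delta']uE; apply: (asym_forall D _ Au umin).
  exact: unif_on_max neg_unif_on neg2_unif_on.
Qed.

End witnesses.

End negation.

(** * The zero-one law and its six values *)

Unset Implicit Arguments.
Set Strict Implicit.
Set Printing Implicit Defensive.

Theorem theorem6p6 (R : realType) (A : set R) (neg : R -> R)
  (A01 : A `<=` `[0, 1]) (A_infinite : infinite_set A) (A_compact : compact A)
  (A0 : A 0) (A1 : A 1)
  (A_min : forall v w, A v -> A w -> A (Num.min v w))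
  (A_max : forall v w, A v -> A w -> A (Num.max v w))
  (A_neg : forall v, A v -> A (neg v))
  (neg_continuous : {within A, continuous neg})
  (neg_min : forall v w, A v -> A w ->
    neg (Num.min v w) = Num.max (neg v) (neg w))
  (neg_max : forall v w, A v -> A w ->
    neg (Num.max v w) = Num.min (neg v) (neg w))
  (neg_neg : forall v, A v -> v <= neg (neg v))
  (neg1 : neg 1 = 0)
  (Rel : finType) (ar : Rel -> nat) (ar_gt0 : forall r, (0 < ar r)%N)
  (p : Rel -> probability R R)
  (p_carrier : forall r, p r A = 1%E)
  (p_full : forall r (U : set R), open U -> A `&` U !=set0 ->
    (0 < p r (A `&` U))%E) :
  let epsilon := sup [set Num.min x (neg x) | x in A] in
  let epsilon' := sup [set Num.min (neg x) (neg (neg x)) | x in A] in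
  let delta := inf [set Num.max x (neg x) | x in A] in
  let delta' := inf [set Num.max (neg x) (neg (neg x)) | x in A] in
  let is_listed (a : R) := [\/ a = 0, a = 1 | a = epsilon] \/
                           [\/ a = epsilon', a = delta | a = delta'] in
  [/\ zero_one_law ar A neg p,
      forall a, almost_sure_value ar A neg p a -> is_listed a &
      (0 < #|Rel|)%N ->
        forall a, is_listed a -> almost_sure_value ar A neg p a].
Proof.
move=> epsilon epsilon' delta delta' is_listed.
have as_unique : forall (phi : formula ar) c c', almost_surely A neg p phi c ->
    almost_surely A neg p phi c' -> c = c'.
  by move=> phi c c'; exact: almost_surely_unique.
have value_listed (phi : formula ar) : sentence phi ->
    exists2 c, listed A neg c & almost_surely A neg p phi c.
  move=> sphi.
  have [c Kc H] := approx_sentence A01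
    (listed_sub A_compact A0 A1 A_neg neg_continuous)
    (@listed0 _ A neg) (@listed1 _ A neg) A_neg
    (listed_neg A01 A_compact A0 A1 A_neg neg_continuous neg_min neg_max neg_neg neg1)
    (neg_unif_on A_compact neg_continuous) neg_min neg_max
    (listed_attained_sup A01 A_compact A0 A1 A_neg neg_continuous neg_min neg_neg neg1)
    (listed_attained_inf A01 A_compact A0 A1 A_neg neg_continuous neg_min neg_neg neg1)
    ar_gt0 sphi.
  by exists c => //; exact: asym_almost_surely.
split.
- move=> phi /value_listed[c Kc Hc]; exists c; split.
    by split=> //; exact: listed_sub Kc.
  by move=> c' [_ Hc']; exact: as_unique Hc Hc'.
- move=> a [_ [phi /value_listed[c Kc Hc] Ha]].
  by rewrite (as_unique _ _ _ Ha Hc); exact: Kc.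
(* Any relation symbol [r], having positive arity, provides the diagonal atom of the witnessing
   sentences. *)
- move=> /card_gt0P[r _] a Ka; split; first exact: listed_sub Ka.
  have [phi sphi H] := listed_asym A01 A_compact A0 A1 A_neg neg_continuous (ar_gt0 r) Ka.
  by exists phi => //; exact: asym_almost_surely.
Qed.
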